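(* Let $k>0$, $R>0$, and let $n\ge1$ be an integer. Let $\gamma_0$ be the unique positive solution of $\log t+t/e=0$, let $0<\gamma<\gamma_0$, and let $\{s(N)\}_{N=1,2,\ldots}$ be an arbitrary sequence of positive numbers satisfying $(R\,s(N))^n=\frac{\gamma}{e}N+O(1)$ as $N\to\infty$. Then for any fixed $(y,\omega)\in B_R\times S^1$, where $B_R$ is the open disc of radius $R$ centered at the origin, we have, as $N\to\infty$, $$\sup_{|x|\le R}\bigl|Hg^{1/n}_{(y,\omega)}(\cdot;s(N),k)_N(x)-E_{1/n}(x-y;s(N),k,\omega)\bigr|$$ $$+\sup_{|x|\le R}\bigl|\nabla\{Hg^{1/n}_{(y,\omega)}(\cdot;s(N),k)_N(x)-E_{1/n}(x-y;s(N),k,\omega)\}\bigr|=O(N^{-\infty}).$$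
   Context: $O(N^{-\infty})$ means $O(N^{-m})$ for every $m\ge 1$. For $g\in L^2(S^1)$, $Hg(x)=\int_{S^1}e^{ikx\cdot\varphi}g(\varphi)\,d\sigma(\varphi)$, $x\in\mathbf{R}^2$ (Herglotz wave function). A point $\vartheta=(\vartheta_1,\vartheta_2)\in S^1$ is identified with the complex number $\vartheta_1+i\vartheta_2$; $\overline\omega\varphi$ is a product of complex numbers, $y\cdot\varphi$ is the real dot product. For $s>0$ and $N=1,2,\ldots$, $$g^{1/n}_{(y,\omega)}(\varphi;s,k)_N=\frac{e^{-iky\cdot\varphi}}{2\pi}\sum_{m=0}^{nN}\frac{\Gamma(m+1)}{\Gamma\left(\frac mn+1\right)}\left(\frac{s\overline\omega\varphi}{ik}\right)^m,\quad\varphi\in S^1.$$ Let $J_m$ be the Bessel function of order $m$. For $0<\alpha\le1$ and $\tau>0$ define $$E^k_\alpha(x;\tau)=\sum_{m=0}^\infty\frac{\{\tau(x_1+ix_2)\}^m}{\Gamma(\alpha m+1)}\left(\frac{2}{k|x|}\right)^m m!\,J_m(k|x|),\quad x=(x_1,x_2)\in\mathbf{R}^2,$$ where $(2/t)^m m!J_m(t)$ is understood as $1$ at $t=0$. For $\omega=(\omega_1,\omega_2)\in S^1$ set $\omega^\perp=(-\omega_2,\omega_1)$ and $$E_{1/n}(x;s,k,\omega)=E^k_{1/n}\left((x\cdot\omega,\,x\cdot\omega^\perp);\frac s2\right),\quad s>0.$$ *)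

(* Defs.v *)
From Stdlib Require Export Reals Factorial.
From Coquelicot Require Export Coquelicot.
Open Scope R_scope.

(* Stdlib's [R] with Coquelicot.  The plane R^2 is Coquelicot's [C = R * R], so
   that x1 + i x2 is the point x itself, |x| is [Cmod x], and S^1 is the set of
   x with [Cmod x = 1]. *)

Definition dot (x y : C) : R := fst x * fst y + snd x * snd y.

Definition perp (w : C) : C := (- snd w, fst w).

Definition expi (t : R) : C := (cos t, sin t).

(* Integral over S^1 with respect to arc length (total mass 2 PI). *)
Definition circle_int (f : C -> C) : C :=
  RInt (V := C_R_CompleteNormedModule) (fun t => f (expi t)) 0 (2 * PI).

Definition CSeries (a : nat -> C) : C :=
  (Series (fun m => Re (a m)), Series (fun m => Im (a m))).

(* Euler's integral; used for x > 0. *)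
Definition Gamma (x : R) : R :=
  RInt_gen (fun t => Rpower t (x - 1) * exp (- t))
    (at_right 0) (Rbar_locally p_infty).

Definition BesselJ (m : nat) (t : R) : R :=
  Series (fun j =>
    (-1) ^ j / (INR (fact j) * INR (fact (m + j))) * (t / 2) ^ (2 * j + m)).

(* (2/t)^m m! J_m(t), with the value 1 at t = 0. *)
Definition BesselJ_scaled (m : nat) (t : R) : R :=
  if Req_dec_T t 0 then 1 else (2 / t) ^ m * INR (fact m) * BesselJ m t.

Definition Herglotz (k : R) (g : C -> C) (x : C) : C :=
  circle_int (fun phi => (expi (k * dot x phi) * g phi)%C).

(* The density g^{1/n}_{(y,w)}(phi; s, k)_N. *)
Definition herglotz_density (n : nat) (y w : C) (s k : R) (N : nat) (phi : C) : C :=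
  (expi (- (k * dot y phi)) / RtoC (2 * PI) *
   sum_n (G := C_AbelianGroup) (fun m =>
     RtoC (Gamma (INR m + 1) / Gamma (INR m / INR n + 1)) *
     (RtoC s * Cconj w * phi / (Ci * RtoC k)) ^ m) (n * N))%C.

(* E^k_alpha(x; tau). *)
Definition Efun (alpha k : R) (x : C) (tau : R) : C :=
  CSeries (fun m =>
    ((RtoC tau * x) ^ m / RtoC (Gamma (alpha * INR m + 1)) *
     RtoC (BesselJ_scaled m (k * Cmod x)))%C).

(* E_{1/n}(x; s, k, w). *)
Definition Edir (n : nat) (x : C) (s k : R) (w : C) : C :=
  Efun (/ INR n) k (dot x w, dot x (perp w)) (s / 2).

(* Real differentiability of a complex-valued function on the plane. *)
Definition differentiable_at (f : C -> C) (x : C) : Prop :=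
  ex_filterdiff (K := R_AbsRing) (U := C_R_NormedModule) (V := C_R_NormedModule)
    f (locally x).

Definition partial1 (f : C -> C) (x : C) : C :=
  (Derive (fun t => Re (f (t, snd x))) (fst x),
   Derive (fun t => Im (f (t, snd x))) (fst x)).

Definition partial2 (f : C -> C) (x : C) : C :=
  (Derive (fun t => Re (f (fst x, t))) (snd x),
   Derive (fun t => Im (f (fst x, t))) (snd x)).

(* Length in C^2 of the gradient of f at x. *)
Definition grad_norm (f : C -> C) (x : C) : R :=
  sqrt (Cmod (partial1 f x) ^ 2 + Cmod (partial2 f x) ^ 2).

(* Supremum over |x| <= r, with value +oo when h is unbounded there. *)
Definition sup_disc (r : R) (h : C -> R) : Rbar :=
  Lub_Rbar (fun v => exists x : C, Cmod x <= r /\ v = h x).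

Definition bounded_eventually (u : nat -> R) : Prop :=
  exists M : R, eventually (fun N => Rabs (u N) <= M).

(* u(N) = O(N^{-oo}), i.e. O(N^{-m}) for every m >= 1. *)
Definition rapidly_decreasing (u : nat -> Rbar) : Prop :=
  forall m : nat, (1 <= m)%nat ->
  exists M : R, eventually (fun N => Rbar_le (Rbar_abs (u N)) (M / INR N ^ m)).

(* Main.v *)
From Stdlib Require Import Lra Lia ZArith IndefiniteDescription.
Require Import Defs.
Open Scope R_scope.

(** By the Jacobi-Anger expansion the Herglotz wave of the [m]-th summand of the
    density is exactly the [m]-th term of the series that defines [Edir]
    ([is_RInt_herglotz_mode], [Herglotz_density_expand], [Edir_expand]).  The
    difference in the theorem is therefore minus the tail, over [m > n N], of the
    series with general term
      [((s/2) conj(w) z)^m / Gamma (m/n + 1) * b_m (- (k |z| / 2)^2)],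
    where [z = x - y] and [b_m] is an entire function dominated by [exp]
    ([herglotz_error_tail]).

    Value and gradient of the tail are estimated at once with a weighted norm of
    second-order Taylor expansions on a disc of radius [d] ([jet_bound]).  This
    norm is submultiplicative and passes to convergent series, and for the
    coordinate function at [z] it is [|z| + d].  Since [|y| < r], the radius
    [d = r - |y|] is positive and satisfies [|x - y| + d <= 2 r] on the whole
    closed disc, so the norm of the [m]-th term is at most
    [(r s)^m / Gamma (m/n + 1) * exp ((k r)^2)] ([jet_bound_herglotz_term]), and
    [jet_bound_differentiable] and [jet_bound_grad] give differentiability and a
    bound on the gradient.

    What remains is the tail of a Mittag-Leffler series at [T = r s(N)], where
    [T^n = gamma N / e + O(1)] ([mittag_leffler_tail_rapidly_decreasing]).  The
    equation [Gamma (x + 1) = x Gamma x] compares terms at distance [n].  Up to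
    index [n N] this produces the factor [(T^n)^N / N!], of size about [gamma^N]
    since [N^N / N! <= e^N]; after it consecutive blocks of [n] terms decrease
    geometrically.  As [ln t + t / e] is increasing and positive at [t = 1], the
    constants satisfy [gamma < gamma0 < 1], and the tail is exponentially small. *)

(** * Series of complex numbers *)

Notation C_is_series a l := (@is_series C_AbsRing C_NormedModule a l).

Lemma CSeries_unique (a : nat -> C) (l : C) : C_is_series a l -> CSeries a = l.
Proof.
intros H.
assert (Hsum : forall n, sum_n (G := C_AbelianGroup) a n
          = (sum_n (fun m => Re (a m)) n, sum_n (fun m => Im (a m)) n)).
{ induction n as [|n IH].
  - rewrite !sum_O. destruct (a 0%nat); reflexivity.
  - rewrite !sum_Sn, IH. destruct (a (S n)); reflexivity. }
destruct l as [l1 l2]; unfold CSeries; f_equal; apply is_series_unique.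
- apply (filterlim_ext (fun n => fst (sum_n (G := C_AbelianGroup) a n))).
  { intros n; rewrite Hsum; reflexivity. }
  eapply filterlim_comp; [exact H|].
  exact (continuous_fst l1 l2).
- apply (filterlim_ext (fun n => snd (sum_n (G := C_AbelianGroup) a n))).
  { intros n; rewrite Hsum; reflexivity. }
  eapply filterlim_comp; [exact H|].
  exact (continuous_snd l1 l2).
Qed.

Lemma CSeries_correct (a : nat -> C) :
  ex_series (fun m => Cmod (a m)) -> C_is_series a (CSeries a).
Proof.
intros H.
assert (E : @ex_series C_AbsRing C_NormedModule a).
{ apply (ex_series_le (V := C_CompleteNormedModule) a _ (fun n => Rle_refl _)).
  exact H. }
destruct E as [l Hl]. rewrite (CSeries_unique _ _ Hl). exact Hl.
Qed.

(** Comparison of partial sums, in the quantitative form that gives uniform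
    convergence: the error of the [n]-th partial sum is at most the error of
    the same partial sum of the dominating real series. *)
Lemma is_series_tail_le (a : nat -> C) (b : nat -> R) (l : C) (lb : R) (n : nat) :
  (forall m, Cmod (a m) <= b m) -> C_is_series a l -> is_series b lb ->
  Cmod (l - sum_n (G := C_AbelianGroup) a n)%C <= lb - sum_n b n.
Proof.
intros Hab Ha Hb.
assert (Hstep : forall m, (n <= m)%nat ->
  Cmod (sum_n (G := C_AbelianGroup) a m - sum_n (G := C_AbelianGroup) a n)%C
    <= sum_n b m - sum_n b n).
{ induction 1 as [|m Hm IH].
  - replace (_ - _)%C with (RtoC 0) by ring. rewrite Cmod_0; lra.
  - rewrite !sum_Sn. unfold plus; simpl.
    replace (_ - _)%C with ((sum_n (G := C_AbelianGroup) a m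
       - sum_n (G := C_AbelianGroup) a n) + a (S m))%C by ring.
    eapply Rle_trans; [apply Cmod_triangle|]. specialize (Hab (S m)).
    lra. }
assert (L1 : filterlim (fun m => Cmod (sum_n (G := C_AbelianGroup) a m
   - sum_n (G := C_AbelianGroup) a n)%C) eventually
   (locally (Cmod (l - sum_n (G := C_AbelianGroup) a n)%C))).
{ apply (filterlim_comp _ _ _
    (fun m => minus (G := C_AbelianGroup) (sum_n a m) (sum_n a n)) Cmod
    eventually (locally (minus (G := C_AbelianGroup) l (sum_n a n)))).
  - apply (filterlim_comp_2 (G := locally l) (H := locally (opp (G := C_AbelianGroup) (sum_n a n)))
       (fun m => sum_n (G := C_AbelianGroup) a m) (fun _ => opp (G := C_AbelianGroup) (sum_n a n)) plus).
    + exact Ha.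
    + apply filterlim_const.
    + apply (filterlim_plus (V := C_NormedModule)).
  - apply (filterlim_norm (V := C_NormedModule)). }
assert (L2 : filterlim (fun m => sum_n b m - sum_n b n) eventually
   (locally (lb - sum_n b n))).
{ apply (is_lim_seq_minus (fun m => sum_n b m) (fun _ => sum_n b n)
    (Finite lb) (Finite (sum_n b n)) (Finite (lb - sum_n b n))).
  - exact Hb.
  - apply is_lim_seq_const.
  - reflexivity. }
apply (filterlim_le (F := eventually)
  (fun m => Cmod (sum_n (G := C_AbelianGroup) a m - sum_n (G := C_AbelianGroup) a n)%C)
  (fun m => sum_n b m - sum_n b n) (Finite _) (Finite _)); trivial.
exists n; intros m Hm; auto.
Qed.

Lemma Cmod_CSeries_le (a : nat -> C) (b : nat -> R) (lb : R) :
  (forall m, Cmod (a m) <= b m) -> is_series b lb -> Cmod (CSeries a) <= lb.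
Proof.
intros Hab Hb.
assert (Ha : C_is_series a (CSeries a)).
{ apply CSeries_correct. apply (ex_series_le (V := R_CompleteNormedModule) _ b).
  - intros m. change (Rabs (Cmod (a m)) <= b m).
    rewrite Rabs_pos_eq; [auto | apply Cmod_ge_0].
  - now exists lb. }
pose proof (is_series_tail_le a b _ lb 0 Hab Ha Hb) as H.
rewrite !sum_O in H. specialize (Hab 0%nat).
replace (CSeries a) with ((CSeries a - a 0%nat) + a 0%nat)%C by ring.
eapply Rle_trans; [apply Cmod_triangle|]. lra.
Qed.

Lemma ex_series_Cmod_le (a : nat -> C) (b : nat -> R) :
  (forall m, Cmod (a m) <= b m) -> ex_series b -> ex_series (fun m => Cmod (a m)).
Proof.
intros Hab Hb. apply (ex_series_le (V := R_CompleteNormedModule) _ b); trivial.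
intros m. change (Rabs (Cmod (a m)) <= b m).
rewrite Rabs_pos_eq; [auto | apply Cmod_ge_0].
Qed.

Lemma is_series_RtoC (a : nat -> R) (l : R) :
  is_series a l -> C_is_series (fun j => RtoC (a j)) (RtoC l).
Proof.
intros H.
apply (filterlim_ext (fun n => RtoC (sum_n a n))).
{ induction x as [|n IH].
  - now rewrite !sum_O.
  - rewrite !sum_Sn, <- IH. change (RtoC (sum_n a n + a (S n)) = (RtoC (sum_n a n) + RtoC (a (S n)))%C).
    apply RtoC_plus. }
eapply filterlim_comp; [exact H|].
intros P [eps HP]. exists eps. intros y Hy. apply HP. split; [exact Hy|apply ball_center].
Qed.

Lemma Series_nonneg (a : nat -> R) :
  (forall m, 0 <= a m) -> ex_series a -> 0 <= Series a.
Proof.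
intros Ha Hex. rewrite <- (Rmult_0_l (Series a)), <- Series_scal_l.
apply Series_le; trivial. intros m; rewrite Rmult_0_l; split; [lra|auto].
Qed.

(** * A submultiplicative bound on second-order Taylor expansions *)

(** [A] bounds a weighted norm of the second-order Taylor expansion of [f] at
    [z], on the disc of radius [d].  The real-linear part is written [p h + q (conj h)]
    (Wirtinger derivatives), because then [|p| + |q|] is exactly 1 for the
    coordinate function and for its conjugate.  The weights [1, d, d^2] make
    the norm submultiplicative and subadditive over convergent series, so that a
    power series in [x] and [conj x] can be bounded by evaluating its majorant
    at [|z| + d].  This replaces termwise differentiation: one bound controls
    the value, the differentiability and the gradient. *)
Definition jet_bound (f : C -> C) (z : C) (d A : R) : Prop :=
  exists (p q : C) (B : R),
    0 <= B /\ Cmod (f z) + (Cmod p + Cmod q) * d + B * d ^ 2 <= A /\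
    forall h : C, Cmod h <= d ->
      Cmod (f (z + h) - f z - (p * h + q * Cconj h))%C <= B * Cmod h ^ 2.

Lemma Cmod_linear_le (p q h : C) :
  Cmod (p * h + q * Cconj h)%C <= (Cmod p + Cmod q) * Cmod h.
Proof.
eapply Rle_trans; [apply Cmod_triangle|]. rewrite !Cmod_mult, Cmod_conj. lra.
Qed.

Lemma jet_bound_value (f : C -> C) (z h : C) (d A : R) :
  jet_bound f z d A -> Cmod h <= d -> Cmod (f (z + h)%C) <= A.
Proof.
intros (p & q & B & HB & HA & Hf) Hh. specialize (Hf h Hh).
replace (f (z + h)%C) with
  (f z + (p * h + q * Cconj h) + (f (z + h) - f z - (p * h + q * Cconj h)))%C by ring.
eapply Rle_trans; [apply Cmod_triangle|].
eapply Rle_trans; [apply Rplus_le_compat_r, Cmod_triangle|].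
pose proof (Cmod_linear_le p q h). pose proof (Cmod_ge_0 h).
pose proof (Cmod_ge_0 p). pose proof (Cmod_ge_0 q).
assert ((Cmod p + Cmod q) * Cmod h <= (Cmod p + Cmod q) * d)
  by (apply Rmult_le_compat_l; lra).
assert (B * Cmod h ^ 2 <= B * d ^ 2)
  by (apply Rmult_le_compat_l; [lra|apply pow_incr; lra]).
lra.
Qed.

Lemma jet_bound_const (c z : C) (d : R) : jet_bound (fun _ => c) z d (Cmod c).
Proof.
exists 0%C, 0%C, 0. repeat split; [lra | rewrite !Cmod_0; lra |].
intros h _. replace (_ - _ - _)%C with (RtoC 0) by ring.
rewrite Cmod_0; lra.
Qed.

Lemma jet_bound_id (z : C) (d : R) : jet_bound (fun x => x) z d (Cmod z + d).
Proof.
exists 1%C, 0%C, 0. repeat split; [lra | rewrite Cmod_0, Cmod_1; lra |].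
intros h _. replace (_ - _ - _)%C with (RtoC 0) by ring.
rewrite Cmod_0; lra.
Qed.

Lemma jet_bound_weaken (f : C -> C) (z : C) (d A A' : R) :
  A <= A' -> jet_bound f z d A -> jet_bound f z d A'.
Proof.
intros HA (p & q & B & HB & H & Hf). exists p, q, B. repeat split; trivial; lra.
Qed.

Lemma jet_bound_ext (f g : C -> C) (z : C) (d A : R) :
  (forall x, f x = g x) -> jet_bound f z d A -> jet_bound g z d A.
Proof.
intros E (p & q & B & HB & H & Hf). exists p, q, B.
repeat split; trivial; [rewrite <- E; trivial|].
intros h Hh; rewrite <- !E; auto.
Qed.

Lemma jet_bound_shift (f : C -> C) (y z : C) (d A : R) :
  jet_bound f (z - y)%C d A -> jet_bound (fun x => f (x - y)%C) z d A.
Proof.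
intros (p & q & B & HB & H & Hf). exists p, q, B. repeat split; trivial.
intros h Hh. replace (z + h - y)%C with (z - y + h)%C by ring. auto.
Qed.

Lemma jet_bound_conj (f : C -> C) (z : C) (d A : R) :
  jet_bound f z d A -> jet_bound (fun x => Cconj (f x)) z d A.
Proof.
intros (p & q & B & HB & H & Hf). exists (Cconj q), (Cconj p), B.
rewrite !Cmod_conj. repeat split; trivial; [lra|].
intros h Hh. rewrite <- (Cmod_conj (_ - _)%C).
rewrite !Cminus_conj, Cplus_conj, !Cmult_conj, !Cconj_conj.
rewrite (Cplus_comm (q * _)). auto.
Qed.

Lemma jet_bound_opp (f : C -> C) (z : C) (d A : R) :
  jet_bound f z d A -> jet_bound (fun x => - f x)%C z d A.
Proof.
intros (p & q & B & HB & H & Hf). exists (- p)%C, (- q)%C, B.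
rewrite !Cmod_opp. repeat split; trivial.
intros h Hh. rewrite <- Cmod_opp.
replace (- _)%C with (f (z + h) - f z - (p * h + q * Cconj h))%C by ring. auto.
Qed.

(** Submultiplicativity.  The product of two truncated expansions has nine
    terms; the three of order greater than two in [h] are absorbed in the
    quadratic remainder through [|h| <= d], and all nine bounds together are
    the product of the two norms. *)
Lemma jet_bound_mult (f g : C -> C) (z : C) (d A A' : R) :
  0 <= d -> jet_bound f z d A -> jet_bound g z d A' ->
  jet_bound (fun x => f x * g x)%C z d (A * A').
Proof.
intros Hd (p & q & B & HB & HA & Hf) (p' & q' & B' & HB' & HA' & Hg).
set (a := Cmod (f z)) in *. set (a' := Cmod (g z)) in *.
set (b := Cmod p + Cmod q) in *. set (b' := Cmod p' + Cmod q') in *.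
assert (0 <= a) by apply Cmod_ge_0. assert (0 <= a') by apply Cmod_ge_0.
assert (0 <= b) by (unfold b; pose proof (Cmod_ge_0 p); pose proof (Cmod_ge_0 q); lra).
assert (0 <= b') by (unfold b'; pose proof (Cmod_ge_0 p'); pose proof (Cmod_ge_0 q'); lra).
assert (0 <= a * B' + b * b' + B * a')
  by (repeat apply Rplus_le_le_0_compat; apply Rmult_le_pos; auto).
assert (0 <= b * B' + B * b')
  by (apply Rplus_le_le_0_compat; apply Rmult_le_pos; auto).
assert (0 <= B * B') by (apply Rmult_le_pos; auto).
exists (f z * p' + p * g z)%C, (f z * q' + q * g z)%C,
  (a * B' + b * b' + B * a' + (b * B' + B * b') * d + B * B' * d ^ 2).
repeat split.
- assert (0 <= (b * B' + B * b') * d) by (apply Rmult_le_pos; auto).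
  assert (0 <= B * B' * d ^ 2) by (apply Rmult_le_pos; auto; apply pow2_ge_0).
  lra.
- eapply Rle_trans; [|apply Rmult_le_compat; [| |exact HA|exact HA']].
  + rewrite Cmod_mult. fold a a'.
    assert (Cmod (f z * p' + p * g z) + Cmod (f z * q' + q * g z) <= a * b' + b * a').
    { eapply Rle_trans; [apply Rplus_le_compat; apply Cmod_triangle|].
      rewrite !Cmod_mult. fold a a'. unfold b, b'. lra. }
    assert ((Cmod (f z * p' + p * g z) + Cmod (f z * q' + q * g z)) * d
       <= (a * b' + b * a') * d) by (apply Rmult_le_compat_r; auto).
    lra.
  + assert (0 <= b * d) by (apply Rmult_le_pos; auto).
    assert (0 <= B * d ^ 2) by (apply Rmult_le_pos; auto; apply pow2_ge_0). lra.
  + assert (0 <= b' * d) by (apply Rmult_le_pos; auto).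
    assert (0 <= B' * d ^ 2) by (apply Rmult_le_pos; auto; apply pow2_ge_0). lra.
- intros h Hh. specialize (Hf h Hh). specialize (Hg h Hh).
  pose proof (Cmod_linear_le p q h) as Lf. pose proof (Cmod_linear_le p' q' h) as Lg.
  fold b in Lf. fold b' in Lg.
  set (lf := (p * h + q * Cconj h)%C) in *. set (lg := (p' * h + q' * Cconj h)%C) in *.
  set (rf := (f (z + h) - f z - lf)%C) in *. set (rg := (g (z + h) - g z - lg)%C) in *.
  replace (_ - _ - _)%C with
    (f z * rg + lf * lg + rf * g z + (lf * rg + rf * lg) + rf * rg)%C
    by (unfold rf, rg, lf, lg; ring).
  set (t := Cmod h) in *. assert (0 <= t) by apply Cmod_ge_0.
  assert (P : forall (c1 c2 : C) (u v : R),
    Cmod c1 <= u -> Cmod c2 <= v -> Cmod (c1 * c2)%C <= u * v).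
  { intros c1 c2 u v H1' H2'. rewrite Cmod_mult.
    apply Rmult_le_compat; auto using Cmod_ge_0. }
  pose proof (P _ _ _ _ (Rle_refl a) Hg) as E1.
  pose proof (P _ _ _ _ Lf Lg) as E2.
  pose proof (P _ _ _ _ Hf (Rle_refl a')) as E3.
  pose proof (P _ _ _ _ Lf Hg) as E4.
  pose proof (P _ _ _ _ Hf Lg) as E5.
  pose proof (P _ _ _ _ Hf Hg) as E6.
  assert (T2 : (b * B' + B * b') * t ^ 3 <= (b * B' + B * b') * d * t ^ 2).
  { replace (t ^ 3) with (t * t ^ 2) by ring. rewrite Rmult_assoc.
    apply Rmult_le_compat_l; trivial.
    apply Rmult_le_compat_r; [apply pow2_ge_0|trivial]. }
  assert (T3 : B * B' * t ^ 4 <= B * B' * d ^ 2 * t ^ 2).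
  { replace (t ^ 4) with (t ^ 2 * t ^ 2) by ring. rewrite (Rmult_assoc (B * B')).
    apply Rmult_le_compat_l; trivial.
    apply Rmult_le_compat_r; [apply pow2_ge_0|apply pow_incr; lra]. }
  pose proof (Cmod_triangle (f z * rg + lf * lg + rf * g z + (lf * rg + rf * lg)) (rf * rg)).
  pose proof (Cmod_triangle (f z * rg + lf * lg + rf * g z) (lf * rg + rf * lg)).
  pose proof (Cmod_triangle (f z * rg + lf * lg) (rf * g z)).
  pose proof (Cmod_triangle (f z * rg) (lf * lg)).
  pose proof (Cmod_triangle (lf * rg) (rf * lg)).
  fold a in E1. fold a' in E3.
  lra.
Qed.

Lemma jet_bound_pow (f : C -> C) (z : C) (d A : R) (m : nat) :
  0 <= d -> jet_bound f z d A -> jet_bound (fun x => f x ^ m)%C z d (A ^ m).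
Proof.
intros Hd Hf. induction m as [|m IH].
- apply (jet_bound_weaken _ _ _ (Cmod 1)); [rewrite Cmod_1; simpl; lra|].
  apply (jet_bound_const 1).
- apply (jet_bound_ext (fun x => f x * f x ^ m)%C); [reflexivity|].
  now apply jet_bound_mult.
Qed.

(** The remainder bound [B |h|^2] is required on a disc that does not depend on
    the term, so it can be summed; no uniform convergence of derivatives is
    involved. *)
Lemma jet_bound_series (f : nat -> C -> C) (z : C) (d : R) (A : nat -> R) (a : R) :
  0 < d -> (forall m, jet_bound (f m) z d (A m)) -> is_series A a ->
  jet_bound (fun x => CSeries (fun m => f m x)) z d a.
Proof.
intros Hd Hf HA.
destruct (functional_choice (fun m (u : C * C * R) => let '(p, q, B) := u in
    0 <= B /\ Cmod (f m z) + (Cmod p + Cmod q) * d + B * d ^ 2 <= A m /\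
    (forall h : C, Cmod h <= d ->
      Cmod (f m (z + h) - f m z - (p * h + q * Cconj h))%C <= B * Cmod h ^ 2)))
  as [u Hu0].
{ intros m. destruct (Hf m) as (p & q & B & H). exists (p, q, B). exact H. }
set (p := fun m => fst (fst (u m))). set (q := fun m => snd (fst (u m))).
set (B := fun m => snd (u m)).
assert (Hu : forall m, 0 <= B m /\
    Cmod (f m z) + (Cmod (p m) + Cmod (q m)) * d + B m * d ^ 2 <= A m /\
    (forall h : C, Cmod h <= d ->
      Cmod (f m (z + h) - f m z - (p m * h + q m * Cconj h))%C <= B m * Cmod h ^ 2)).
{ intros m. unfold p, q, B. specialize (Hu0 m). destruct (u m) as [[? ?] ?]. exact Hu0. }
assert (Hd2 : 0 < d ^ 2) by (apply pow_lt; trivial).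
assert (HB0 : forall m, 0 <= B m) by (intros m; apply Hu).
assert (HAm : forall m, Cmod (f m z) + (Cmod (p m) + Cmod (q m)) * d + B m * d ^ 2 <= A m)
  by (intros m; apply Hu).
assert (Hpos : forall m, 0 <= Cmod (p m) * d /\ 0 <= Cmod (q m) * d /\ 0 <= B m * d ^ 2
   /\ 0 <= Cmod (f m z)).
{ intros m; repeat split; try apply Rmult_le_pos; auto using Cmod_ge_0; lra. }
assert (exA : ex_series A) by now exists a.
assert (exAd : ex_series (fun m => / d * A m))
  by now apply (ex_series_scal_l (V := R_NormedModule)).
assert (exAd2 : ex_series (fun m => / d ^ 2 * A m))
  by now apply (ex_series_scal_l (V := R_NormedModule)).
assert (sf : ex_series (fun m => Cmod (f m z))).
{ apply (ex_series_Cmod_le _ A); trivial. intros m.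
  specialize (Hpos m); specialize (HAm m). lra. }
assert (sp : ex_series (fun m => Cmod (p m))).
{ apply (ex_series_Cmod_le _ (fun m => / d * A m)); trivial. intros m.
  specialize (Hpos m); specialize (HAm m).
  apply (Rmult_le_reg_r d); trivial. field_simplify; lra. }
assert (sq : ex_series (fun m => Cmod (q m))).
{ apply (ex_series_Cmod_le _ (fun m => / d * A m)); trivial. intros m.
  specialize (Hpos m); specialize (HAm m).
  apply (Rmult_le_reg_r d); trivial. field_simplify; lra. }
assert (sB : ex_series B).
{ apply (ex_series_le (V := R_CompleteNormedModule) _ (fun m => / d ^ 2 * A m)); trivial.
  intros m. specialize (Hpos m); specialize (HAm m).
  change (Rabs (B m) <= / d ^ 2 * A m). rewrite Rabs_pos_eq; trivial.
  apply (Rmult_le_reg_r (d ^ 2)); trivial.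
  replace (/ d ^ 2 * A m * d ^ 2) with (A m) by (field; lra). lra. }
exists (CSeries p), (CSeries q), (Series B). split; [|split].
- now apply Series_nonneg.
- assert (HS : is_series
    (fun m => Cmod (f m z) + (Cmod (p m) + Cmod (q m)) * d + B m * d ^ 2)
    (Series (fun m => Cmod (f m z)) + (Series (fun m => Cmod (p m))
       + Series (fun m => Cmod (q m))) * d + Series B * d ^ 2)).
  { apply (is_series_plus (V := R_NormedModule)
      (fun m => Cmod (f m z) + (Cmod (p m) + Cmod (q m)) * d) (fun m => B m * d ^ 2)).
    - apply (is_series_plus (V := R_NormedModule)
        (fun m => Cmod (f m z)) (fun m => (Cmod (p m) + Cmod (q m)) * d)).
      + now apply Series_correct.
      + apply is_series_scal_r.
        apply (is_series_plus (V := R_NormedModule)); now apply Series_correct.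
    - apply is_series_scal_r. now apply Series_correct. }
  assert (HSa : Series (fun m => Cmod (f m z) + (Cmod (p m) + Cmod (q m)) * d + B m * d ^ 2)
     <= Series A).
  { apply Series_le; trivial. intros m. specialize (Hpos m). specialize (HAm m). lra. }
  rewrite (is_series_unique _ _ HS), (is_series_unique _ _ HA) in HSa.
  pose proof (Cmod_CSeries_le _ _ _ (fun m => Rle_refl _) (Series_correct _ sf)).
  pose proof (Cmod_CSeries_le _ _ _ (fun m => Rle_refl _) (Series_correct _ sp)).
  pose proof (Cmod_CSeries_le _ _ _ (fun m => Rle_refl _) (Series_correct _ sq)).
  assert ((Cmod (CSeries p) + Cmod (CSeries q)) * d <=
    (Series (fun m => Cmod (p m)) + Series (fun m => Cmod (q m))) * d)
    by (apply Rmult_le_compat_r; lra).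
  lra.
- intros h Hh.
  assert (sfh : ex_series (fun m => Cmod (f m (z + h)%C))).
  { apply (ex_series_Cmod_le _ A); trivial. intros m.
    apply (jet_bound_value _ _ _ d); trivial. }
  assert (HR : C_is_series
    (fun m => f m (z + h) - f m z - (p m * h + q m * Cconj h))%C
    (CSeries (fun m => f m (z + h)%C) - CSeries (fun m => f m z)
       - (CSeries p * h + CSeries q * Cconj h))%C).
  { apply (is_series_minus (V := C_NormedModule) (fun m => f m (z + h) - f m z)%C
      (fun m => p m * h + q m * Cconj h)%C).
    - apply (is_series_minus (V := C_NormedModule)); now apply CSeries_correct.
    - apply (is_series_plus (V := C_NormedModule) (fun m => p m * h)%C (fun m => q m * Cconj h)%C).
      + rewrite Cmult_comm. eapply is_series_ext; [intros m; apply (Cmult_comm h)|].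
        apply (is_series_scal_l (V := C_NormedModule)). now apply CSeries_correct.
      + rewrite Cmult_comm. eapply is_series_ext; [intros m; apply (Cmult_comm (Cconj h))|].
        apply (is_series_scal_l (V := C_NormedModule)). now apply CSeries_correct. }
  rewrite <- (CSeries_unique _ _ HR).
  apply (Cmod_CSeries_le _ (fun m => B m * Cmod h ^ 2)).
  + intros m. now apply Hu.
  + apply is_series_scal_r. now apply Series_correct.
Qed.

Lemma norm_C_R (x : C) : norm (V := C_R_NormedModule) x = Cmod x.
Proof.
destruct x as [a b]. unfold Cmod.
change (sqrt (Rabs a ^ 2 + Rabs b ^ 2) = sqrt (a ^ 2 + b ^ 2)).
now rewrite !pow2_abs.
Qed.

Lemma jet_bound_differentiable (f : C -> C) (z : C) (d A : R) :
  0 < d -> jet_bound f z d A -> differentiable_at f z.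
Proof.
intros Hd (p & q & B & HB & HA & Hf).
exists (fun h : C => (p * h + q * Cconj h)%C). split.
- apply (Build_is_linear (K := R_AbsRing) (U := C_R_NormedModule) (V := C_R_NormedModule)).
  + intros x y. change (p * (x + y) + q * Cconj (x + y)
      = p * x + q * Cconj x + (p * y + q * Cconj y))%C.
    rewrite Cplus_conj. ring.
  + intros k x.
    apply injective_projections; simpl; unfold scal; simpl; unfold mult; simpl; ring.
  + exists (Cmod p + Cmod q + 1).
    pose proof (Cmod_ge_0 p). pose proof (Cmod_ge_0 q). split; [lra|].
    intros x. rewrite !norm_C_R. eapply Rle_trans; [apply Cmod_linear_le|].
    apply Rmult_le_compat_r; [apply Cmod_ge_0|lra].
- intros x Hx.
  apply (is_filter_lim_locally_unique (V := C_R_NormedModule)) in Hx. subst x.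
  intros eps.
  assert (Hr : 0 < Rmin d (eps / (B + 1))).
  { apply Rmin_pos; trivial. apply Rdiv_lt_0_compat; [apply cond_pos|lra]. }
  apply (locally_le_locally_norm (V := C_R_NormedModule)).
  exists (mkposreal _ Hr). intros y Hy.
  unfold ball_norm in Hy. rewrite norm_C_R in *. rewrite norm_C_R. simpl in Hy.
  set (h := minus (G := C_R_NormedModule) y z) in *.
  replace (f y) with (f (z + h)%C) by (f_equal; unfold h; change (z + (y - z) = y)%C; ring).
  change (Cmod (f (z + h) - f z - (p * h + q * Cconj h))%C <= eps * Cmod h).
  eapply Rle_trans; [apply Hf|].
  { left; eapply Rlt_le_trans; [exact Hy|apply Rmin_l]. }
  replace (B * Cmod h ^ 2) with (B * Cmod h * Cmod h) by ring.
  apply Rmult_le_compat_r; [apply Cmod_ge_0|].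
  assert (Cmod h <= eps / (B + 1)).
  { left; eapply Rlt_le_trans; [exact Hy|apply Rmin_r]. }
  apply Rle_trans with (B * (eps / (B + 1))); [now apply Rmult_le_compat_l|].
  assert (eps / (B + 1) * (B + 1) = eps) by (field; lra).
  assert (0 <= eps / (B + 1)) by (left; apply Rdiv_lt_0_compat; [apply cond_pos|lra]).
  lra.
Qed.

Lemma is_derive_of_quadratic (g : R -> R) (t l B d : R) :
  0 < d -> 0 <= B ->
  (forall u, Rabs u <= d -> Rabs (g (t + u) - g t - l * u) <= B * u ^ 2) ->
  is_derive g t l.
Proof.
intros Hd HB Hg. apply is_derive_Reals. intros eps Heps.
assert (Hr : 0 < Rmin d (eps / (B + 1))).
{ apply Rmin_pos; trivial. apply Rdiv_lt_0_compat; lra. }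
exists (mkposreal _ Hr). intros u Hu Hud. simpl in Hud.
assert (Hu1 : Rabs u <= d) by (left; eapply Rlt_le_trans; [exact Hud|apply Rmin_l]).
assert (Hu2 : Rabs u < eps / (B + 1)) by (eapply Rlt_le_trans; [exact Hud|apply Rmin_r]).
specialize (Hg u Hu1).
assert (Hup : 0 < Rabs u) by now apply Rabs_pos_lt.
replace ((g (t + u) - g t) / u - l) with ((g (t + u) - g t - l * u) / u) by (field; trivial).
unfold Rdiv. rewrite Rabs_mult, Rabs_inv.
apply (Rmult_lt_reg_r (Rabs u)); trivial.
rewrite Rmult_assoc, Rinv_l, Rmult_1_r by lra.
eapply Rle_lt_trans; [exact Hg|].
rewrite <- pow2_abs. replace (B * Rabs u ^ 2) with (B * Rabs u * Rabs u) by ring.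
apply Rmult_lt_compat_r; trivial.
assert (eps / (B + 1) * (B + 1) = eps) by (field; lra).
assert (Rabs u * (B + 1) < eps) by (rewrite <- H; apply Rmult_lt_compat_r; lra).
lra.
Qed.

Lemma im_le_Cmod (c : C) : Rabs (Im c) <= Cmod c.
Proof. eapply Rle_trans; [apply Rmax_r|apply Rmax_Cmod]. Qed.

(** The partial derivatives are [p + q] and [i (p - q)], and
    [(|p| + |q|) d <= A]: an analogue of Cauchy's estimate. *)
Lemma jet_bound_grad (f : C -> C) (z : C) (d A : R) :
  0 < d -> jet_bound f z d A -> grad_norm f z <= 2 * A / d.
Proof.
intros Hd (p & q & B & HB & HA & Hf).
assert (H1 : partial1 f z = (p + q)%C).
{ assert (K : forall u, Rabs u <= d ->
    Cmod (f ((fst z + u)%R, snd z) - f z - (p + q) * RtoC u)%C <= B * u ^ 2).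
  { intros u Hu. specialize (Hf (RtoC u)). rewrite Cmod_R, pow2_abs in Hf.
    specialize (Hf Hu). eapply Rle_trans; [|exact Hf]. right. f_equal.
    replace (z + u)%C with ((fst z + u)%R, snd z)
      by (apply injective_projections; simpl; ring).
    replace (Cconj u) with (RtoC u) by (apply injective_projections; simpl; ring).
    ring. }
  unfold partial1. rewrite (surjective_pairing (p + q)%C). f_equal.
  - apply is_derive_unique, (is_derive_of_quadratic _ _ _ B d); trivial.
    intros u Hu. eapply Rle_trans; [|exact (K u Hu)].
    eapply Rle_trans; [|apply re_le_Cmod]. right; f_equal.
    rewrite <- surjective_pairing. unfold Re; simpl; ring.
  - apply is_derive_unique, (is_derive_of_quadratic _ _ _ B d); trivial.
    intros u Hu. eapply Rle_trans; [|exact (K u Hu)].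
    eapply Rle_trans; [|apply im_le_Cmod]. right; f_equal.
    rewrite <- surjective_pairing. unfold Im; simpl; ring. }
assert (H2 : partial2 f z = (Ci * (p - q))%C).
{ assert (K : forall u, Rabs u <= d ->
    Cmod (f (fst z, (snd z + u)%R) - f z - (Ci * (p - q)) * RtoC u)%C <= B * u ^ 2).
  { intros u Hu. specialize (Hf (Ci * u)%C). rewrite Cmod_mult, Cmod_Ci, Cmod_R, Rmult_1_l, pow2_abs in Hf.
    specialize (Hf Hu). eapply Rle_trans; [|exact Hf]. right. f_equal.
    replace (z + Ci * u)%C with (fst z, (snd z + u)%R)
      by (apply injective_projections; simpl; ring).
    replace (Cconj (Ci * u)) with (- Ci * u)%C by (apply injective_projections; simpl; ring).
    ring. }
  unfold partial2. rewrite (surjective_pairing (Ci * (p - q))%C). f_equal.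
  - apply is_derive_unique, (is_derive_of_quadratic _ _ _ B d); trivial.
    intros u Hu. eapply Rle_trans; [|exact (K u Hu)].
    eapply Rle_trans; [|apply re_le_Cmod]. right; f_equal.
    rewrite <- surjective_pairing. unfold Re; simpl; ring.
  - apply is_derive_unique, (is_derive_of_quadratic _ _ _ B d); trivial.
    intros u Hu. eapply Rle_trans; [|exact (K u Hu)].
    eapply Rle_trans; [|apply im_le_Cmod]. right; f_equal.
    rewrite <- surjective_pairing. unfold Im; simpl; ring. }
assert (Hs : Cmod p + Cmod q <= A / d).
{ apply (Rmult_le_reg_r d); trivial. unfold Rdiv; rewrite Rmult_assoc, Rinv_l, Rmult_1_r by lra.
  pose proof (Cmod_ge_0 (f z)). assert (0 <= B * d ^ 2) by (apply Rmult_le_pos; [lra|apply pow2_ge_0]). lra. }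
pose proof (Cmod_ge_0 p). pose proof (Cmod_ge_0 q).
unfold grad_norm. rewrite H1, H2, Cmod_mult, Cmod_Ci, Rmult_1_l.
assert (L1 : Cmod (p + q) <= A / d) by (eapply Rle_trans; [apply Cmod_triangle|lra]).
assert (L2 : Cmod (p - q) <= A / d)
  by (eapply Rle_trans; [apply Cmod_triangle|rewrite Cmod_opp; lra]).
replace (2 * A / d) with (sqrt ((2 * (A / d)) ^ 2)).
2:{ rewrite sqrt_pow2 by lra. unfold Rdiv; ring. }
apply sqrt_le_1_alt.
pose proof (pow_incr _ _ 2 (conj (Cmod_ge_0 (p + q)) L1)).
pose proof (pow_incr _ _ 2 (conj (Cmod_ge_0 (p - q)) L2)).
pose proof (pow2_ge_0 (A / d)).
replace ((2 * (A / d)) ^ 2) with (4 * (A / d) ^ 2) by ring. lra.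
Qed.

(** * The Gamma function *)

Lemma is_series_exp (x : R) : is_series (fun m => x ^ m / INR (fact m)) (exp x).
Proof.
eapply is_series_ext; [|exact (proj1 (is_pseries_R _ _ _) (is_exp_Reals x))].
intros m; simpl. unfold Rdiv; ring.
Qed.

Lemma pow_div_fact_le_exp (x : R) (n : nat) : 0 <= x -> x ^ n / INR (fact n) <= exp x.
Proof.
intros Hx. pose proof (is_series_exp x) as H.
assert (Hp : forall m, 0 <= x ^ m / INR (fact m)).
{ intros m. apply Rmult_le_pos; [now apply pow_le|].
  left; apply Rinv_0_lt_compat, INR_fact_lt_0. }
apply Rle_trans with (sum_n (fun m => x ^ m / INR (fact m)) n).
- destruct n; [rewrite sum_O; apply Rle_refl|]. rewrite sum_Sn. unfold plus; simpl plus.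
  assert (0 <= sum_n (fun m => x ^ m / INR (fact m)) n).
  { clear - Hp. induction n as [|n IH]; [rewrite sum_O; apply Hp|]. rewrite sum_Sn.
    apply Rplus_le_le_0_compat; [exact IH|apply Hp]. }
  change (x ^ S n / INR (fact (S n))
    <= sum_n (fun m => x ^ m / INR (fact m)) n + x ^ S n / INR (fact (S n))). lra.
- apply (is_lim_seq_incr_compare (sum_n (fun m => x ^ m / INR (fact m)))); [exact H|].
  intros m. rewrite sum_Sn. specialize (Hp (S m)).
  change (sum_n (fun m => x ^ m / INR (fact m)) m
    <= sum_n (fun m => x ^ m / INR (fact m)) m + x ^ S m / INR (fact (S m))). lra.
Qed.

Lemma exp_nondecreasing (x y : R) : x <= y -> exp x <= exp y.
Proof.
intros [H | ->]; [left; now apply exp_increasing|apply Rle_refl].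
Qed.

(** Half of the exponential decay absorbs the power, the other half is kept as
    an integrable majorant. *)
Lemma Rpower_mult_exp_le (a : R) : 0 <= a ->
  exists M : R, 0 < M /\ forall t, 0 < t -> Rpower t a * exp (- t) <= M * exp (- t / 2).
Proof.
intros Ha. destruct (INR_unbounded a) as [p Hp].
exists (1 + 2 ^ p * INR (fact p)).
assert (Hc : 0 < 2 ^ p * INR (fact p)).
{ apply Rmult_lt_0_compat; [apply pow_lt; lra|apply INR_fact_lt_0]. }
split; [lra|]. intros t Ht.
replace (exp (- t)) with (exp (- t / 2) * exp (- t / 2)).
2:{ rewrite <- exp_plus; f_equal; field. }
rewrite <- Rmult_assoc. apply Rmult_le_compat_r; [left; apply exp_pos|].
assert (E : exp (- t / 2) * exp (t / 2) = 1).
{ rewrite <- exp_plus, <- exp_0. f_equal; field. }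
apply (Rmult_le_reg_r (exp (t / 2))); [apply exp_pos|].
rewrite Rmult_assoc, E, Rmult_1_r.
destruct (Rle_lt_dec t 1) as [H1|H1].
- apply Rle_trans with 1.
  + unfold Rpower. rewrite <- exp_0. apply exp_nondecreasing.
    assert (ln t <= 0) by (rewrite <- ln_1; apply ln_le; lra).
    apply (Rmult_le_compat_l a) in H; lra.
  + pose proof (exp_ineq1_le (t / 2)).
    apply Rle_trans with (1 * exp (t / 2)); [lra|].
    apply Rmult_le_compat_r; [left; apply exp_pos|lra].
- apply Rle_trans with (t ^ p).
  + rewrite <- Rpower_pow by lra. apply Rle_Rpower; lra.
  + pose proof (pow_div_fact_le_exp (t / 2) p ltac:(lra)) as H.
    apply Rle_trans with (2 ^ p * INR (fact p) * exp (t / 2)).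
    * apply (Rmult_le_compat_l _ _ _ (Rlt_le _ _ Hc)) in H.
      eapply Rle_trans; [|exact H]. right. unfold Rdiv. rewrite Rpow_mult_distr, pow_inv.
      field. split; [apply INR_fact_neq_0|apply pow_nonzero; lra].
    * apply Rmult_le_compat_r; [left; apply exp_pos|lra].
Qed.

(** For a nonnegative integrand the integrals from [e] to [b] grow with the
    interval, so the improper integral is their least upper bound; this
    handles the ends [0] and infinity together. *)
Lemma is_RInt_gen_of_bounded (f : R -> R) (M : R) :
  (forall t, 0 < t -> continuous f t) -> (forall t, 0 < t -> 0 <= f t) ->
  (forall e b, 0 < e <= b -> RInt f e b <= M) ->
  exists l : R, is_RInt_gen f (at_right 0) (Rbar_locally p_infty) l /\
    forall e b, 0 < e <= b -> RInt f e b <= l.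
Proof.
intros Hc Hp HM.
assert (Hex : forall e b, 0 < e -> 0 < b -> ex_RInt f e b).
{ intros e b He Hb. apply (ex_RInt_continuous (V := R_CompleteNormedModule)). intros t Ht. apply Hc.
  assert (0 < Rmin e b) by now apply Rmin_pos. lra. }
destruct (completeness (fun v => exists e b, 0 < e <= b /\ v = RInt f e b)) as [l [Hub Hlub]].
{ exists M. intros v (e & b & H & ->). auto. }
{ exists (RInt f 1 1), 1, 1. split; [lra|reflexivity]. }
assert (Hle : forall e b, 0 < e <= b -> RInt f e b <= l).
{ intros e b H. apply Hub. now exists e, b. }
exists l. split; trivial. intros P [eps HP].
destruct (Classical_Prop.classic (exists e b, 0 < e <= b /\ l - eps < RInt f e b))
  as [(e0 & b0 & H0 & Hgt)|Hn].
2:{ exfalso. assert (l <= l - eps).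
  { apply Hlub. intros v (e & b & H & ->). apply Rnot_lt_le. intros Hlt.
    apply Hn. now exists e, b. }
  pose proof (cond_pos eps). lra. }
apply (Filter_prod _ _ _ (fun e => 0 < e < e0) (fun b => b0 < b)).
- exists (mkposreal e0 (proj1 H0)). intros t Ht Ht0. split; trivial.
  change (Rabs (t - 0) < e0) in Ht. rewrite Rabs_pos_eq in Ht; lra.
- exists b0; auto.
- intros e b He Hb. simpl. exists (RInt f e b). split.
  { apply (RInt_correct (V := R_CompleteNormedModule)). apply Hex; lra. }
  apply HP. change (Rabs (RInt f e b - l) < eps).
  assert (Hbig : RInt f e0 b0 <= RInt f e b).
  { rewrite <- (RInt_Chasles f e e0 b), <- (RInt_Chasles f e0 b0 b) by (apply Hex; lra).
    assert (0 <= RInt f e e0) by (apply RInt_ge_0; [lra|apply Hex; lra|intros; apply Hp; lra]).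
    assert (0 <= RInt f b0 b) by (apply RInt_ge_0; [lra|apply Hex; lra|intros; apply Hp; lra]).
    unfold plus; simpl. lra. }
  pose proof (Hle e b ltac:(lra)). apply Rabs_def1; lra.
Qed.

Lemma continuous_Gamma_integrand (a t : R) :
  0 < t -> continuous (fun t => Rpower t a * exp (- t)) t.
Proof.
intros Ht. apply (ex_derive_continuous (V := R_NormedModule)). unfold Rpower. now auto_derive.
Qed.

Lemma Gamma_correct (x : R) : 1 <= x ->
  is_RInt_gen (fun t => Rpower t (x - 1) * exp (- t))
    (at_right 0) (Rbar_locally p_infty) (Gamma x) /\ 0 < Gamma x.
Proof.
intros Hx. set (f := fun t => Rpower t (x - 1) * exp (- t)).
assert (Hpos : forall t, 0 < f t).
{ intros t. apply Rmult_lt_0_compat; apply exp_pos. }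
assert (Hc : forall t, 0 < t -> continuous f t) by (intros; now apply continuous_Gamma_integrand).
assert (Hex : forall e b, 0 < e <= b -> ex_RInt f e b).
{ intros e b He. apply (ex_RInt_continuous (V := R_CompleteNormedModule)). intros t Ht. apply Hc. rewrite Rmin_left in Ht; lra. }
destruct (Rpower_mult_exp_le (x - 1)) as (M & HM & Hle); [lra|].
destruct (is_RInt_gen_of_bounded f (2 * M)) as (l & Hl & Hub); trivial.
- intros t _; apply Rlt_le, Hpos.
- intros e b He.
  assert (HI : is_RInt (fun t => M * exp (- t / 2)) e b
      (- (2 * M * exp (- b / 2)) - - (2 * M * exp (- e / 2)))).
  { apply (is_RInt_derive (V := R_CompleteNormedModule) (fun t => - (2 * M * exp (- t / 2)))).
    - intros t _. auto_derive; trivial.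
      unfold Rdiv; field.
    - intros t _. apply (ex_derive_continuous (V := R_NormedModule)). now auto_derive. }
  apply Rle_trans with (RInt (fun t => M * exp (- t / 2)) e b).
  + apply RInt_le; [lra|auto|eexists; exact HI|]. intros t Ht. apply Hle; lra.
  + rewrite (is_RInt_unique _ _ _ _ HI).
    assert (exp (- e / 2) <= exp 0) by (apply exp_nondecreasing; lra). rewrite exp_0 in H.
    pose proof (exp_pos (- b / 2)).
    assert (0 <= 2 * M * exp (- b / 2)) by (apply Rmult_le_pos; lra).
    apply (Rmult_le_compat_l (2 * M)) in H; lra.
- assert (E : Gamma x = l).
  { exact (is_RInt_gen_unique (V := R_CompleteNormedModule) f l Hl). }
  rewrite E. split; trivial.
  eapply Rlt_le_trans; [|apply (Hub 1 2); lra].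
  apply RInt_gt_0; [lra|auto|]. intros t Ht. apply Hc; lra.
Qed.

Lemma Gamma_pos (x : R) : 1 <= x -> 0 < Gamma x.
Proof. intros Hx. now apply Gamma_correct. Qed.

Lemma filterlim_Rpower_mult_exp_infty (a : R) : 0 <= a ->
  filterlim (fun t => Rpower t a * exp (- t)) (Rbar_locally p_infty) (locally 0).
Proof.
intros Ha. destruct (Rpower_mult_exp_le a Ha) as (M & HM & Hle).
intros P [eps HP].
assert (0 < 2 * M / eps) by (apply Rdiv_lt_0_compat; [lra|apply cond_pos]).
exists (2 * M / eps). intros t Ht. apply HP.
change (Rabs (Rpower t a * exp (- t) - 0) < eps).
rewrite Rminus_0_r, Rabs_pos_eq by (apply Rmult_le_pos; left; apply exp_pos).
eapply Rle_lt_trans; [apply Hle; lra|].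
pose proof (exp_ineq1_le (t / 2)) as He.
assert (E : exp (- t / 2) * exp (t / 2) = 1).
{ rewrite <- exp_plus, <- exp_0. f_equal; field. }
apply (Rmult_lt_reg_r (exp (t / 2))); [apply exp_pos|].
rewrite Rmult_assoc, E, Rmult_1_r.
pose proof (cond_pos eps).
apply Rlt_le_trans with (eps * (t / 2)).
- apply (Rmult_lt_compat_l eps) in Ht; trivial.
  replace (eps * (2 * M / eps)) with (2 * M) in Ht by (field; lra). lra.
- apply Rmult_le_compat_l; lra.
Qed.

Lemma filterlim_Rpower_mult_exp_0 (a : R) : 1 <= a ->
  filterlim (fun t => Rpower t a * exp (- t)) (at_right 0) (locally 0).
Proof.
intros Ha P [eps HP].
assert (Hm : 0 < Rmin 1 eps) by (apply Rmin_pos; [lra|apply cond_pos]).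
exists (mkposreal _ Hm). intros t Ht Ht0. apply HP.
change (Rabs (t - 0) < Rmin 1 eps) in Ht. rewrite Rminus_0_r, Rabs_pos_eq in Ht by lra.
pose proof (Rmin_l 1 eps). pose proof (Rmin_r 1 eps).
change (Rabs (Rpower t a * exp (- t) - 0) < eps).
rewrite Rminus_0_r, Rabs_pos_eq by (apply Rmult_le_pos; left; apply exp_pos).
apply Rle_lt_trans with (t * 1); [|lra].
apply Rmult_le_compat; try (left; apply exp_pos).
- unfold Rpower. rewrite <- (exp_ln t) at 2 by trivial. apply exp_nondecreasing.
  assert (ln t <= 0) by (rewrite <- ln_1; apply ln_le; lra).
  assert (0 <= (a - 1) * - ln t) by (apply Rmult_le_pos; lra). lra.
- rewrite <- exp_0. apply exp_nondecreasing. lra.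
Qed.

Lemma filter_prod_pos (P : R -> Prop) :
  (forall t, 0 < t -> P t) ->
  filter_prod (at_right 0) (Rbar_locally p_infty)
    (fun ab : R * R => forall t, Rmin (fst ab) (snd ab) <= t <= Rmax (fst ab) (snd ab) -> P t).
Proof.
intros HP. apply (Filter_prod _ _ _ (fun e => 0 < e) (fun b => 0 < b)).
- exists (mkposreal 1 Rlt_0_1). now intros t _ Ht.
- now exists 0.
- intros e b He Hb t Ht. apply HP. simpl in Ht.
  pose proof (Rmin_pos e b He Hb). lra.
Qed.

(** Integration by parts: the derivative of [- t^x exp (- t)], whose limits at
    both ends vanish, is the difference of the two integrands. *)
Lemma Gamma_succ (x : R) : 1 <= x -> Gamma (x + 1) = x * Gamma x.
Proof.
intros Hx.
set (g := fun t => - (Rpower t x * exp (- t))).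
set (g' := fun t => Rpower t x * exp (- t) - x * (Rpower t (x - 1) * exp (- t))).
assert (Hd : forall t, 0 < t -> is_derive g t (g' t)).
{ intros t Ht. unfold g, g', Rpower. auto_derive; trivial.
  replace (exp ((x - 1) * ln t)) with (exp (x * ln t) * / t).
  - field; lra.
  - rewrite <- (exp_ln t) at 2 by trivial. rewrite <- exp_Ropp, <- exp_plus. f_equal; ring. }
assert (H1 : is_RInt_gen (Derive g) (at_right 0) (Rbar_locally p_infty) (- 0 - - 0)).
{ apply is_RInt_gen_Derive.
  - apply filter_prod_pos. intros t Ht. exists (g' t). auto.
  - apply filter_prod_pos. intros t Ht.
    apply (continuous_ext_loc _ g').
    + exists (mkposreal t Ht). intros u Hu. change (Rabs (u - t) < t) in Hu.
      apply Rabs_def2 in Hu. symmetry. apply is_derive_unique, Hd. lra.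
    + apply (ex_derive_continuous (V := R_NormedModule)). unfold g', Rpower. now auto_derive.
  - apply (filterlim_comp _ _ _ (fun t => Rpower t x * exp (- t)) Ropp _ (locally 0));
      [now apply filterlim_Rpower_mult_exp_0|].
    exact (filterlim_opp (V := R_NormedModule) (0 : R)).
  - apply (filterlim_comp _ _ _ (fun t => Rpower t x * exp (- t)) Ropp _ (locally 0));
      [apply filterlim_Rpower_mult_exp_infty; lra|].
    exact (filterlim_opp (V := R_NormedModule) (0 : R)). }
assert (H2 : is_RInt_gen (Derive g) (at_right 0) (Rbar_locally p_infty)
               (Gamma (x + 1) - x * Gamma x)).
{ apply (is_RInt_gen_ext (V := R_NormedModule) g').
  - apply (filter_imp (F := filter_prod (at_right 0) (Rbar_locally p_infty))
      (fun ab : R * R => forall t, Rmin (fst ab) (snd ab) <= t <= Rmax (fst ab) (snd ab)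
         -> g' t = Derive g t)).
    + intros ab H t Ht. apply H. lra.
    + apply filter_prod_pos. intros t Ht. symmetry. apply is_derive_unique. auto.
  - apply (is_RInt_gen_minus (V := R_NormedModule) (fun t => Rpower t x * exp (- t))).
    + pose proof (proj1 (Gamma_correct (x + 1) ltac:(lra))) as H.
      now replace (x + 1 - 1) with x in H by ring.
    + apply (is_RInt_gen_scal (V := R_NormedModule)). now apply Gamma_correct. }
pose proof (is_RInt_gen_unique (V := R_CompleteNormedModule) _ _ H1) as U1.
pose proof (is_RInt_gen_unique (V := R_CompleteNormedModule) _ _ H2) as U2.
rewrite U1 in U2. lra.
Qed.

Lemma Gamma_1 : Gamma 1 = 1.
Proof.
set (g := fun t => - exp (- t)).
assert (Hd : forall t, is_derive g t (exp (- t))).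
{ intros t. unfold g. auto_derive; trivial. ring. }
assert (H1 : is_RInt_gen (Derive g) (at_right 0) (Rbar_locally p_infty) (- 0 - - 1)).
{ apply is_RInt_gen_Derive.
  - apply filter_prod_pos. intros t Ht. eexists; apply Hd.
  - apply filter_prod_pos. intros t Ht.
    apply (continuous_ext (fun t => exp (- t))).
    + intros u. symmetry. apply is_derive_unique, Hd.
    + apply (ex_derive_continuous (V := R_NormedModule)). now auto_derive.
  - apply
      (filterlim_filter_le_1 (F := locally 0) (G := at_right 0) g (filter_le_within _)).
    replace (-1) with (g 0) by (unfold g; rewrite Ropp_0, exp_0; lra).
    apply (ex_derive_continuous (V := R_NormedModule)). eexists; apply Hd.
  - eapply (filterlim_comp _ _ _ (fun t => exp (- t)) Ropp).
    2: exact (filterlim_opp (V := R_NormedModule) (0 : R)).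
    eapply (filterlim_ext_loc (F := Rbar_locally p_infty));
      [|apply (filterlim_Rpower_mult_exp_infty 0); lra].
    exists 0. intros t Ht. rewrite Rpower_O by trivial. ring. }
assert (H2 : is_RInt_gen (Derive g) (at_right 0) (Rbar_locally p_infty) (Gamma 1)).
{ apply (is_RInt_gen_ext (V := R_NormedModule) (fun t => Rpower t (1 - 1) * exp (- t))).
  - apply (filter_imp (F := filter_prod (at_right 0) (Rbar_locally p_infty))
      (fun ab : R * R => forall t, Rmin (fst ab) (snd ab) <= t <= Rmax (fst ab) (snd ab)
         -> Rpower t (1 - 1) * exp (- t) = Derive g t)).
    + intros ab H t Ht. apply H. lra.
    + apply filter_prod_pos. intros t Ht. rewrite (is_derive_unique _ _ _ (Hd t)).
      rewrite Rminus_diag, Rpower_O by trivial. ring.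
  - apply Gamma_correct. lra. }
pose proof (is_RInt_gen_unique (V := R_CompleteNormedModule) _ _ H1) as U1.
pose proof (is_RInt_gen_unique (V := R_CompleteNormedModule) _ _ H2) as U2.
rewrite U1 in U2. lra.
Qed.

Lemma Gamma_fact (m : nat) : Gamma (INR m + 1) = INR (fact m).
Proof.
induction m as [|m IH].
- simpl. rewrite Rplus_0_l. apply Gamma_1.
- rewrite S_INR, Gamma_succ, IH, fact_simpl, mult_INR, S_INR; [ring|].
  pose proof (pos_INR m). lra.
Qed.

(** * Fourier modes of exponential monomials on the circle *)

Notation C_is_RInt f a b l := (@is_RInt C_R_NormedModule f a b l).

(** Equalities at the carrier of a module structure on [C] are restated at [C]
    itself, where [ring] and [field] recognise the operations. *)
Ltac as_C_eq := match goal with |- @eq _ ?u ?v => change (@eq C u v) end.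

Lemma is_RInt_Cscal (c : C) (f : R -> C) (a b : R) (l : C) :
  C_is_RInt f a b l -> C_is_RInt (fun t => c * f t)%C a b (c * l)%C.
Proof.
intros H.
pose proof (is_RInt_fct_extend_fst (U := R_NormedModule) (V := R_NormedModule) f a b l H) as H1.
pose proof (is_RInt_fct_extend_snd (U := R_NormedModule) (V := R_NormedModule) f a b l H) as H2.
apply (is_RInt_fct_extend_pair (U := R_NormedModule) (V := R_NormedModule)
  (fun t => c * f t)%C a b (fst (c * l)%C) (snd (c * l)%C)).
- apply (is_RInt_minus (V := R_NormedModule)
   (fun t => fst c * fst (f t)) (fun t => snd c * snd (f t))).
  + now apply (is_RInt_scal (V := R_NormedModule)).
  + now apply (is_RInt_scal (V := R_NormedModule)).
- apply (is_RInt_plus (V := R_NormedModule)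
   (fun t => fst c * snd (f t)) (fun t => snd c * fst (f t))).
  + now apply (is_RInt_scal (V := R_NormedModule)).
  + now apply (is_RInt_scal (V := R_NormedModule)).
Qed.

Lemma expi_plus (a b : R) : expi (a + b) = (expi a * expi b)%C.
Proof.
unfold expi. rewrite cos_plus, sin_plus.
apply injective_projections; simpl; ring.
Qed.

Lemma expi_opp (a : R) : expi (- a) = Cconj (expi a).
Proof. unfold expi, Cconj. simpl. now rewrite cos_neg, sin_antisym. Qed.

Lemma expi_0 : expi 0 = 1.
Proof. unfold expi. now rewrite cos_0, sin_0. Qed.

Lemma expi_INR (m : nat) (t : R) : (expi t ^ m)%C = expi (IZR (Z.of_nat m) * t).
Proof.
induction m as [|m IH].
- rewrite Rmult_0_l, expi_0. reflexivity.
- rewrite Cpow_S, IH, <- expi_plus. f_equal.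
  rewrite Nat2Z.inj_succ, succ_IZR. ring.
Qed.

Lemma Cmod_expi (t : R) : Cmod (expi t) = 1.
Proof.
unfold Cmod, expi. simpl fst; simpl snd.
rewrite <- !Rsqr_pow2, Rplus_comm, sin2_cos2. apply sqrt_1.
Qed.

Lemma is_RInt_expi (p : Z) :
  C_is_RInt (fun t => expi (IZR p * t)) 0 (2 * PI)
    (if Z.eq_dec p 0 then RtoC (2 * PI) else RtoC 0).
Proof.
destruct (Z.eq_dec p 0) as [->|Hp].
- apply (is_RInt_ext (fun _ => RtoC 1)).
  { intros t _. now rewrite Rmult_0_l, expi_0. }
  replace (RtoC (2 * PI)) with (scal (V := C_R_NormedModule) (2 * PI - 0) (RtoC 1)).
  + apply (is_RInt_const (V := C_R_NormedModule)).
  + apply injective_projections; simpl; unfold scal; simpl; unfold mult; simpl; ring.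
- assert (Hp' : IZR p <> 0) by now apply not_0_IZR.
  assert (Hs : sin (IZR p * PI) = 0) by (apply sin_eq_0_1; now exists p).
  apply (is_RInt_fct_extend_pair (U := R_NormedModule) (V := R_NormedModule)
    (fun t => expi (IZR p * t)) 0 (2 * PI) 0 0).
  + replace 0 with (sin (IZR p * (2 * PI)) / IZR p - sin (IZR p * 0) / IZR p) at 2.
    * apply (is_RInt_derive (V := R_CompleteNormedModule) (fun t => sin (IZR p * t) / IZR p)).
      -- intros t _. simpl. auto_derive; trivial. now field.
      -- intros t _. simpl. apply (ex_derive_continuous (V := R_NormedModule)). now auto_derive.
    * replace (IZR p * (2 * PI)) with (2 * (IZR p * PI)) by ring.
      rewrite sin_2a, Hs, (Rmult_0_r (IZR p)), sin_0. now field.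
  + replace 0 with (- cos (IZR p * (2 * PI)) / IZR p - - cos (IZR p * 0) / IZR p) at 2.
    * apply (is_RInt_derive (V := R_CompleteNormedModule) (fun t => - cos (IZR p * t) / IZR p)).
      -- intros t _. simpl. auto_derive; trivial. now field.
      -- intros t _. simpl. apply (ex_derive_continuous (V := R_NormedModule)). now auto_derive.
    * replace (IZR p * (2 * PI)) with (2 * (IZR p * PI)) by ring.
      rewrite cos_2a_sin, Hs, (Rmult_0_r (IZR p)), cos_0. now field.
Qed.

(** At [phi = expi t] the last factor is [phi^p]; it is written with an integer
    [p] because the recursion on [l] moves [p] in both directions. *)
Definition mode (al be : C) (l : nat) (p : Z) (t : R) : C :=
  ((al * Cconj (expi t) + be * expi t) ^ l / RtoC (INR (fact l)) * expi (IZR p * t))%C.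

Lemma RtoC_INR_fact_neq_0 (n : nat) : RtoC (INR (fact n)) <> 0.
Proof. intros H. apply RtoC_inj in H. now apply (INR_fact_neq_0 n). Qed.

Lemma RtoC_INR_S_neq_0 (n : nat) : RtoC (INR (S n)) <> 0.
Proof. intros H. apply RtoC_inj in H. now apply (not_0_INR (S n)). Qed.

(** Multiplying by [conj phi] or [phi] shifts the Fourier index by one. *)
Lemma is_RInt_mode_S (al be : C) (l : nat) (p : Z) (v1 v2 : C) :
  C_is_RInt (mode al be l (p - 1)) 0 (2 * PI) v1 ->
  C_is_RInt (mode al be l (p + 1)) 0 (2 * PI) v2 ->
  C_is_RInt (mode al be (S l) p) 0 (2 * PI) ((al * v1 + be * v2) / RtoC (INR (S l)))%C.
Proof.
intros H1 H2.
apply (is_RInt_ext (fun t => / RtoC (INR (S l)) *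
   (al * mode al be l (p - 1) t + be * mode al be l (p + 1) t))%C).
- intros t _. unfold mode.
  rewrite fact_simpl, mult_INR, RtoC_mult.
  rewrite minus_IZR, plus_IZR, Rmult_minus_distr_r, Rmult_plus_distr_r, Rmult_1_l.
  unfold Rminus. rewrite !expi_plus, expi_opp, Cpow_S.
  as_C_eq. field. split; [apply RtoC_INR_fact_neq_0|apply RtoC_INR_S_neq_0].
- unfold Cdiv. rewrite Cmult_comm. apply is_RInt_Cscal.
  apply (is_RInt_plus (V := C_R_NormedModule)); now apply is_RInt_Cscal.
Qed.

(** The constant Fourier mode survives only for the monomial with [i] factors
    [al conj(phi)] and [j] factors [be phi] when [i - j = p].  Induction by
    the shift recursion needs both cases at once. *)
Lemma is_RInt_mode (al be : C) (l : nat) :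
  (forall i j, (i + j = l)%nat ->
     C_is_RInt (mode al be l (Z.of_nat i - Z.of_nat j)) 0 (2 * PI)
       (RtoC (2 * PI) * al ^ i * be ^ j / RtoC (INR (fact i) * INR (fact j)))%C) /\
  (forall p, (forall i j, (i + j = l)%nat -> p <> Z.of_nat i - Z.of_nat j)%Z ->
     C_is_RInt (mode al be l p) 0 (2 * PI) (RtoC 0)).
Proof.
induction l as [|l [IH1 IH2]].
- assert (E : forall p t, expi (IZR p * t) = mode al be 0 p t).
  { intros p t. unfold mode. simpl. as_C_eq. field. }
  split.
  + intros i j Hij. replace i with 0%nat by lia. replace j with 0%nat by lia.
    apply (is_RInt_ext (fun t => expi (IZR 0 * t))); [intros t _; apply E|].
    pose proof (is_RInt_expi 0) as H. simpl in H.
    replace (_ / _)%C with (RtoC (2 * PI)); trivial.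
    simpl. rewrite Rmult_1_l. field.
  + intros p Hp. specialize (Hp 0%nat 0%nat eq_refl).
    apply (is_RInt_ext (fun t => expi (IZR p * t))); [intros t _; apply E|].
    pose proof (is_RInt_expi p) as H. destruct (Z.eq_dec p 0); [lia|exact H].
- split.
  + intros i j Hij.
    set (V := fun i j => (RtoC (2 * PI) * al ^ i * be ^ j / RtoC (INR (fact i) * INR (fact j)))%C) in *.
    set (v1 := match i with O => RtoC 0 | S i' => V i' j end).
    set (v2 := match j with O => RtoC 0 | S j' => V i j' end).
    change (C_is_RInt (mode al be (S l) (Z.of_nat i - Z.of_nat j)) 0 (2 * PI) (V i j)).
    replace (V i j) with ((al * v1 + be * v2) / RtoC (INR (S l)))%C.
    * apply is_RInt_mode_S; unfold v1, v2.
      -- destruct i as [|i].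
         ++ apply IH2. intros; lia.
         ++ replace (Z.of_nat (S i) - Z.of_nat j - 1)%Z with (Z.of_nat i - Z.of_nat j)%Z by lia.
            apply IH1. lia.
      -- destruct j as [|j].
         ++ apply IH2. intros; lia.
         ++ replace (Z.of_nat i - Z.of_nat (S j) + 1)%Z with (Z.of_nat i - Z.of_nat j)%Z by lia.
            apply IH1. lia.
    * assert (E1 : (al * v1 = RtoC (INR i) * V i j)%C).
      { unfold v1, V. destruct i as [|i]; [simpl; ring|].
        rewrite fact_simpl, mult_INR, !RtoC_mult, Cpow_S. field.
        repeat split; auto using RtoC_INR_fact_neq_0, RtoC_INR_S_neq_0. }
      assert (E2 : (be * v2 = RtoC (INR j) * V i j)%C).
      { unfold v2, V. destruct j as [|j]; [simpl; ring|].
        rewrite fact_simpl, mult_INR, !RtoC_mult, Cpow_S. field.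
        repeat split; auto using RtoC_INR_fact_neq_0, RtoC_INR_S_neq_0. }
      rewrite E1, E2, <- Hij, plus_INR, RtoC_plus. field.
      rewrite <- RtoC_plus, <- plus_INR, Hij. apply RtoC_INR_S_neq_0.
  + intros p Hp.
    replace (RtoC 0) with ((al * 0 + be * 0) / RtoC (INR (S l)))%C
      by (field; apply RtoC_INR_S_neq_0).
    apply is_RInt_mode_S; apply IH2; intros i j Hij E.
    * apply (Hp (S i) j); lia.
    * apply (Hp i (S j)); lia.
Qed.

Lemma Cmod_pow_div_fact (c : C) (l : nat) :
  Cmod (c ^ l / RtoC (INR (fact l)))%C = Cmod c ^ l / INR (fact l).
Proof.
rewrite Cmod_div by apply RtoC_INR_fact_neq_0.
rewrite Cmod_pow, Cmod_R, Rabs_pos_eq; trivial. apply pos_INR.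
Qed.

Lemma Ci_pow_even (j : nat) : (Ci ^ (2 * j))%C = RtoC ((-1) ^ j).
Proof.
rewrite Cpow_mult_r, RtoC_pow. f_equal. apply injective_projections; simpl; ring.
Qed.

(** Splitting the series into even and odd indices gives the real series that
    define [cos] and [sin]. *)
Lemma is_series_expi (x : R) :
  C_is_series (fun l => (Ci * RtoC x) ^ l / RtoC (INR (fact l)))%C (expi x).
Proof.
assert (Hex : ex_series (fun l => Cmod ((Ci * RtoC x) ^ l / RtoC (INR (fact l)))%C)).
{ apply (ex_series_Cmod_le _ (fun l => Rabs x ^ l / INR (fact l))).
  - intros l. rewrite Cmod_pow_div_fact, Cmod_mult, Cmod_Ci, Cmod_R, Rmult_1_l. apply Rle_refl.
  - eexists; apply is_series_exp. }
replace (expi x) with (CSeries (fun l => (Ci * RtoC x) ^ l / RtoC (INR (fact l)))%C);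
  [now apply CSeries_correct|].
set (a := fun l => Re (Ci ^ l) / INR (fact l)).
set (b := fun l => Im (Ci ^ l) / INR (fact l)).
assert (E : forall l, ((Ci * RtoC x) ^ l / RtoC (INR (fact l)))%C = (a l * x ^ l, b l * x ^ l)).
{ intros l. rewrite Cpow_mult_l, <- RtoC_pow. unfold Cdiv.
  rewrite <- RtoC_inv by apply INR_fact_neq_0. unfold a, b, Re, Im.
  apply injective_projections; simpl; unfold Rdiv; ring. }
assert (Hc : is_series (fun j => (-1) ^ j / INR (fact (2 * j)) * (x ^ 2) ^ j) (cos x)).
{ unfold cos. destruct (exist_cos (Rsqr x)) as [v Hv]. apply is_series_Reals in Hv.
  eapply is_series_ext; [|exact Hv]. intros j. simpl. unfold cos_n. now rewrite Rsqr_pow2. }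
assert (Hs : exists v, is_series (fun j => (-1) ^ j / INR (fact (2 * j + 1)) * (x ^ 2) ^ j) v
   /\ sin x = x * v).
{ unfold sin. destruct (exist_sin (Rsqr x)) as [v Hv]. exists v. split; trivial.
  apply is_series_Reals in Hv.
  eapply is_series_ext; [|exact Hv]. intros j. simpl. unfold sin_n. now rewrite Rsqr_pow2. }
destruct Hs as (v & Hs & Hsv).
assert (Ea : forall j, a (2 * j)%nat = (-1) ^ j / INR (fact (2 * j)) /\ a (2 * j + 1)%nat = 0 /\
   b (2 * j)%nat = 0 /\ b (2 * j + 1)%nat = (-1) ^ j / INR (fact (2 * j + 1))).
{ intros j. unfold a, b. rewrite Cpow_add_r, Ci_pow_even, Cpow_1_r.
  unfold Re, Im; simpl; repeat split; unfold Rdiv; ring. }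
assert (H0 : is_pseries (fun _ => 0) (x ^ 2) 0).
{ apply is_pseries_R. eapply is_series_ext; [intros; symmetry; apply Rmult_0_l|].
  eapply is_series_ext; [intros; apply (Rmult_0_l 0)|].
  pose proof (is_series_scal_l (V := R_NormedModule) 0 _ _ (is_series_exp 0)) as Hz.
  unfold scal in Hz; simpl in Hz; unfold mult in Hz; simpl in Hz. rewrite Rmult_0_l in Hz.
  eapply is_series_ext; [|exact Hz]. intros n; simpl; ring. }
assert (HA : is_pseries a x (cos x + x * 0)).
{ apply is_pseries_odd_even.
  - apply is_pseries_R. eapply is_series_ext; [|exact Hc]. intros j.
    now rewrite (proj1 (Ea j)).
  - apply (is_pseries_ext (fun _ => 0)); [|exact H0]. intros j. symmetry. apply Ea. }
assert (HB : is_pseries b x (0 + x * v)).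
{ apply is_pseries_odd_even.
  - apply (is_pseries_ext (fun _ => 0)); [|exact H0]. intros j. symmetry. apply Ea.
  - apply is_pseries_R. eapply is_series_ext; [|exact Hs]. intros j.
    destruct (Ea j) as (_ & _ & _ & ->). reflexivity. }
apply is_pseries_R, is_series_unique in HA. apply is_pseries_R, is_series_unique in HB.
unfold CSeries, expi. f_equal.
- rewrite <- (Rplus_0_r (cos x)), <- (Rmult_0_r x) at 1. rewrite <- HA. apply Series_ext.
  intros l. now rewrite E.
- rewrite Hsv, <- (Rplus_0_l (x * v)), <- HB. apply Series_ext.
  intros l. now rewrite E.
Qed.

(** * Plane waves and Bessel functions *)

Definition bessel_coef (m j : nat) : R := INR (fact m) / (INR (fact j) * INR (fact (m + j))).

(** The entire function with [bessel_reduced m (- (t / 2)^2) = (2/t)^m m! J_m(t)].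
    As a function of [t^2] it makes the smoothness at the origin of
    [x |-> (2 / |x|)^m m! J_m(|x|)] visible. *)
Definition bessel_reduced (m : nat) (u : R) : R := Series (fun j => bessel_coef m j * u ^ j).

Lemma bessel_coef_bound (m j : nat) : 0 <= bessel_coef m j <= / INR (fact j).
Proof.
unfold bessel_coef.
pose proof (INR_fact_lt_0 m). pose proof (INR_fact_lt_0 j). pose proof (INR_fact_lt_0 (m + j)).
assert (INR (fact m) <= INR (fact (m + j))) by (apply le_INR, fact_le; lia).
split.
- apply Rmult_le_pos; [lra|]. left; apply Rinv_0_lt_compat, Rmult_lt_0_compat; trivial.
- apply (Rmult_le_reg_r (INR (fact j) * INR (fact (m + j)))).
  + now apply Rmult_lt_0_compat.
  + field_simplify; lra.
Qed.

Lemma ex_series_bessel (m : nat) (u : R) : ex_series (fun j => bessel_coef m j * u ^ j).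
Proof.
apply (ex_series_le (V := R_CompleteNormedModule) _ (fun j => Rabs u ^ j / INR (fact j))).
- intros j. change (Rabs (bessel_coef m j * u ^ j) <= Rabs u ^ j / INR (fact j)).
  destruct (bessel_coef_bound m j).
  rewrite Rabs_mult, (Rabs_pos_eq (bessel_coef m j)), <- RPow_abs by trivial.
  unfold Rdiv. rewrite Rmult_comm. apply Rmult_le_compat_l; trivial.
  apply pow_le, Rabs_pos.
- eexists; apply is_series_exp.
Qed.

Lemma dot_le (z : C) (t : R) : Rabs (dot z (expi t)) <= Cmod z.
Proof.
replace (dot z (expi t)) with (Re (z * Cconj (expi t))%C)
  by (unfold dot, expi, Re; simpl; ring).
eapply Rle_trans; [apply re_le_Cmod|]. rewrite Cmod_mult, Cmod_conj, Cmod_expi. lra.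
Qed.

Lemma is_RInt_sum_n (f : nat -> R -> C) (a b : R) (v : nat -> C) (n : nat) :
  (forall l, C_is_RInt (f l) a b (v l)) ->
  C_is_RInt (fun t => sum_n (G := C_AbelianGroup) (fun l => f l t) n) a b
    (sum_n (G := C_AbelianGroup) v n).
Proof.
intros Hf. induction n as [|n IH].
- rewrite sum_O. apply (is_RInt_ext (f 0%nat)); [intros; now rewrite sum_O|apply Hf].
- rewrite sum_Sn.
  apply (is_RInt_ext (fun t => plus (G := C_AbelianGroup)
     (sum_n (G := C_AbelianGroup) (fun l => f l t) n) (f (S n) t))); [intros; now rewrite sum_Sn|].
  now apply (is_RInt_plus (V := C_R_NormedModule)).
Qed.

Lemma sum_n_sparse (v w : nat -> C) (m J : nat) :
  (forall l, (l < m)%nat -> v l = 0) ->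
  (forall j, v (m + 2 * j)%nat = w j) -> (forall j, v (m + 2 * j + 1)%nat = 0) ->
  sum_n (G := C_AbelianGroup) v (m + 2 * J) = sum_n (G := C_AbelianGroup) w J.
Proof.
intros H0 Hw H1. induction J as [|J IH].
- rewrite sum_O, <- Hw. replace (m + 2 * 0)%nat with m by lia.
  destruct m as [|m]; [apply sum_O|]. rewrite sum_Sn.
  replace (sum_n (G := C_AbelianGroup) v m) with (zero (G := C_AbelianGroup)); [apply plus_zero_l|].
  assert (Hz : forall n, (n <= m)%nat -> sum_n (G := C_AbelianGroup) v n = zero).
  { induction n as [|n IH]; intros Hn.
    - rewrite sum_O. apply H0; lia.
    - rewrite sum_Sn, IH, plus_zero_l by lia. apply H0; lia. }
  symmetry; now apply Hz.
- replace (m + 2 * S J)%nat with (S (S (m + 2 * J))) by lia.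
  rewrite !sum_Sn, IH. replace (S (m + 2 * J)) with (m + 2 * J + 1)%nat by lia.
  rewrite H1. change (RtoC 0) with (zero (G := C_AbelianGroup)). rewrite plus_zero_r.
  f_equal. rewrite <- Hw. f_equal. lia.
Qed.

(** The Jacobi-Anger expansion: the [m]-th Fourier coefficient of a plane wave
    is a Bessel function.  With [z . phi = (z conj(phi) + conj(z) phi) / 2] the
    exponential series of the phase converges uniformly in [phi], so it may be
    integrated term by term, and [is_RInt_mode] leaves one monomial for every
    [l = m + 2 j]. *)
Lemma is_RInt_herglotz_mode (k : R) (z : C) (m : nat) :
  C_is_RInt (fun t => expi (k * dot z (expi t)) * expi t ^ m)%C 0 (2 * PI)
    (RtoC (2 * PI) * (Ci * RtoC k * z / 2) ^ m / RtoC (INR (fact m))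
       * RtoC (bessel_reduced m (- (k * Cmod z / 2) ^ 2)))%C.
Proof.
set (al := (Ci * RtoC k * z / 2)%C). set (be := (Ci * RtoC k * Cconj z / 2)%C).
set (K := Rabs k * Cmod z).
assert (Hphase : forall t, (al * Cconj (expi t) + be * expi t = Ci * RtoC (k * dot z (expi t)))%C).
{ intros t. unfold al, be, dot, expi. destruct z as [x y].
  apply injective_projections; simpl; field. }
set (w := fun j => (RtoC (2 * PI) * al ^ (m + j) * be ^ j
                     / RtoC (INR (fact (m + j)) * INR (fact j)))%C).
set (v := fun l => RInt (V := C_R_CompleteNormedModule) (mode al be l (Z.of_nat m)) 0 (2 * PI)).
assert (Hodd : forall l, (forall i j, (i + j = l)%nat -> Z.of_nat m <> Z.of_nat i - Z.of_nat j)%Z ->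
   C_is_RInt (mode al be l (Z.of_nat m)) 0 (2 * PI) (RtoC 0)).
{ intros l. apply (is_RInt_mode al be l). }
assert (Heven : forall j, C_is_RInt (mode al be (m + 2 * j) (Z.of_nat m)) 0 (2 * PI) (w j)).
{ intros j. pose proof (proj1 (is_RInt_mode al be (m + 2 * j)) (m + j)%nat j ltac:(lia)) as H.
  now replace (Z.of_nat (m + j) - Z.of_nat j)%Z with (Z.of_nat m) in H by lia. }
assert (Hcase : forall l, ((forall i j, (i + j = l)%nat -> Z.of_nat m <> Z.of_nat i - Z.of_nat j)%Z)
    \/ exists j, l = (m + 2 * j)%nat).
{ intros l. destruct (le_lt_dec m l) as [Hl|Hl]; [|left; intros; lia].
  destruct (Nat.Even_or_Odd (l - m)) as [[j Hj]|[j Hj]]; [right; exists j; lia|left; intros; lia]. }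
assert (Hv : forall l, C_is_RInt (mode al be l (Z.of_nat m)) 0 (2 * PI) (v l)).
{ intros l. apply (RInt_correct (V := C_R_CompleteNormedModule)).
  destruct (Hcase l) as [H|[j ->]]; eexists; [now apply Hodd|apply Heven]. }
set (F := fun J t => sum_n (G := C_AbelianGroup)
                       (fun l => mode al be l (Z.of_nat m) t) (m + 2 * J)).
assert (HF : forall J, C_is_RInt (F J) 0 (2 * PI) (sum_n (G := C_AbelianGroup) w J)).
{ intros J. rewrite <- (sum_n_sparse v w m).
  - now apply is_RInt_sum_n.
  - intros l Hl. apply (is_RInt_unique (V := C_R_CompleteNormedModule)), Hodd. intros; lia.
  - intros j. apply (is_RInt_unique (V := C_R_CompleteNormedModule)), Heven.
  - intros j. apply (is_RInt_unique (V := C_R_CompleteNormedModule)), Hodd. intros; lia. }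
assert (Hunif : filterlim F eventually (locally (T := fct_UniformSpace R C_R_CompleteNormedModule)
    (fun t => expi (k * dot z (expi t)) * expi t ^ m)%C)).
{ intros P [eps HP].
  assert (HK : 0 <= K) by (apply Rmult_le_pos; [apply Rabs_pos|apply Cmod_ge_0]).
  pose proof (is_series_exp K) as HS.
  destruct (HS (ball (exp K) eps)) as [L HL]; [now exists eps|].
  exists L. intros J HJ. apply HP. intros t.
  specialize (HL (m + 2 * J)%nat ltac:(lia)).
  change (Rabs (sum_n (fun m => K ^ m / INR (fact m)) (m + 2 * J) - exp K) < eps) in HL.
  apply Rabs_def2 in HL.
  set (th := k * dot z (expi t)).
  assert (Hth : Rabs th <= K).
  { unfold th, K. rewrite Rabs_mult. apply Rmult_le_compat_l; [apply Rabs_pos|apply dot_le]. }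
  assert (HE : C_is_series (fun l => mode al be l (Z.of_nat m) t) (expi th * expi t ^ m)%C).
  { rewrite Cmult_comm. eapply is_series_ext;
      [|apply (is_series_scal_l (V := C_NormedModule)), (is_series_expi th)].
    intros l. unfold mode. rewrite Hphase, expi_INR. fold th. apply Cmult_comm. }
  assert (HB : Cmod (expi th * expi t ^ m - F J t)%C < eps).
  { eapply Rle_lt_trans;
      [apply (is_series_tail_le _ (fun l => K ^ l / INR (fact l)) _ (exp K)); trivial|lra].
    intros l. unfold mode. rewrite Hphase. fold th.
    rewrite Cmod_mult, Cmod_expi, Cmod_pow_div_fact, Cmod_mult, Cmod_Ci, Cmod_R, Rmult_1_l, Rmult_1_r.
    apply Rmult_le_compat_r; [left; apply Rinv_0_lt_compat, INR_fact_lt_0|].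
    apply pow_incr. split; [apply Rabs_pos|trivial]. }
  change (@ball C_UniformSpace (expi th * expi t ^ m)%C eps (F J t)).
  revert HB. generalize (expi th * expi t ^ m)%C (F J t). intros c c' HB.
  apply C_NormedModule_mixin_compat1. rewrite <- Cmod_opp.
  replace (- minus c' c)%C with (c - c')%C; [exact HB|].
  change (c - c' = - (c' - c))%C. ring. }
(* The limit [If] of the integrals exists; the Bessel series identifies it. *)
destruct (filterlim_RInt (V := C_R_CompleteNormedModule) F 0 (2 * PI) eventually
  eventually_filter (fun t => expi (k * dot z (expi t)) * expi t ^ m)%C _ HF Hunif) as (If & Hlim & HI).
assert (Hw : C_is_series w (RtoC (2 * PI) * al ^ m / RtoC (INR (fact m))
       * RtoC (bessel_reduced m (- (k * Cmod z / 2) ^ 2)))%C).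
{ apply (is_series_ext (fun j => scal (V := C_NormedModule)
     (RtoC (2 * PI) * al ^ m / RtoC (INR (fact m)))%C
     (RtoC (bessel_coef m j * (- (k * Cmod z / 2) ^ 2) ^ j)))).
  - intros j. change ((RtoC (2 * PI) * al ^ m / RtoC (INR (fact m))
      * RtoC (bessel_coef m j * (- (k * Cmod z / 2) ^ 2) ^ j))%C = w j).
    assert (E : RtoC ((- (k * Cmod z / 2) ^ 2) ^ j) = (al ^ j * be ^ j)%C).
    { rewrite RtoC_pow, <- Cpow_mult_l. f_equal. unfold al, be.
      replace (Ci * RtoC k * z / 2 * (Ci * RtoC k * Cconj z / 2))%C
        with (Ci * Ci * RtoC k * RtoC k * (z * Cconj z) / 4)%C by field.
      rewrite <- Cmod2_conj. apply injective_projections; simpl; field. }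
    unfold w, bessel_coef. rewrite (RtoC_mult _ (_ ^ j)), E, Cpow_add_r.
    rewrite RtoC_div, !RtoC_mult.
    + field. repeat split; apply RtoC_INR_fact_neq_0.
    + apply Rmult_integral_contrapositive; split; apply INR_fact_neq_0.
  - apply (is_series_scal_l (V := C_NormedModule)), is_series_RtoC.
    apply Series_correct, ex_series_bessel. }
rewrite (filterlim_locally_unique (F := eventually) _ _ _ Hw Hlim). exact HI.
Qed.

(** * The Herglotz wave as a partial sum *)

(** General term shared by [Edir], which is the sum of the whole series, and the
    Herglotz wave, which is a partial sum. *)
Definition herglotz_term (k s : R) (n : nat) (w : C) (m : nat) (z : C) : C :=
  (RtoC (/ Gamma (INR m / INR n + 1)) * (RtoC (s / 2) * Cconj w * z) ^ m
     * RtoC (bessel_reduced m (- (k * Cmod z / 2) ^ 2)))%C.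

Lemma sum_n_Cmult_l (c : C) (a : nat -> C) (n : nat) :
  (c * sum_n (G := C_AbelianGroup) a n)%C = sum_n (G := C_AbelianGroup) (fun m => c * a m)%C n.
Proof.
induction n as [|n IH].
- now rewrite !sum_O.
- rewrite !sum_Sn, <- IH.
  change (c * (sum_n (G := C_AbelianGroup) a n + a (S n))
    = c * sum_n (G := C_AbelianGroup) a n + c * a (S n))%C. ring.
Qed.

Lemma Herglotz_density_expand (k s : R) (n N : nat) (y w x : C) : k <> 0 ->
  Herglotz k (herglotz_density n y w s k N) x
    = sum_n (G := C_AbelianGroup) (fun m => herglotz_term k s n w m (x - y)%C) (n * N).
Proof.
intros Hk.
assert (Hkc : RtoC k <> 0) by (intros E; apply RtoC_inj in E; contradiction).
assert (Hpi : RtoC (2 * PI) <> 0).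
{ intros E. apply RtoC_inj in E. pose proof PI_RGT_0. lra. }
assert (HCi : Ci <> 0) by (intros E; apply (f_equal snd) in E; simpl in E; lra).
set (cf := fun m => (/ RtoC (2 * PI) *
  (RtoC (Gamma (INR m + 1) / Gamma (INR m / INR n + 1)) * (RtoC s * Cconj w / (Ci * RtoC k)) ^ m))%C).
apply (is_RInt_unique (V := C_R_CompleteNormedModule)).
apply (is_RInt_ext (V := C_R_NormedModule) (fun t => sum_n (G := C_AbelianGroup)
  (fun m => cf m * (expi (k * dot (x - y) (expi t)) * expi t ^ m))%C (n * N))).
{ intros t _. unfold herglotz_density.
  set (e1 := expi (k * dot x (expi t))). set (e2 := expi (- (k * dot y (expi t)))).
  assert (E : expi (k * dot (x - y) (expi t)) = (e1 * e2)%C).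
  { unfold e1, e2. rewrite <- expi_plus. f_equal. unfold dot; simpl. ring. }
  rewrite Cmult_assoc, sum_n_Cmult_l. apply (sum_n_ext (G := C_AbelianGroup)). intros m. rewrite E. unfold cf.
  replace (RtoC s * Cconj w * expi t / (Ci * RtoC k))%C
    with (RtoC s * Cconj w / (Ci * RtoC k) * expi t)%C by (field; auto).
  rewrite (Cpow_mult_l _ (expi t)). unfold Cdiv. as_C_eq. ring. }
match goal with |- C_is_RInt _ _ _ ?v => replace v with
  (sum_n (G := C_AbelianGroup) (fun m => cf m *
     (RtoC (2 * PI) * (Ci * RtoC k * (x - y) / 2) ^ m / RtoC (INR (fact m))
       * RtoC (bessel_reduced m (- (k * Cmod (x - y) / 2) ^ 2))))%C (n * N)) end.
{ apply (is_RInt_sum_n (fun m t => cf m * (expi (k * dot (x - y) (expi t)) * expi t ^ m))%C).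
  intros m. apply is_RInt_Cscal, is_RInt_herglotz_mode. }
apply (sum_n_ext (G := C_AbelianGroup)). intros m. unfold cf, herglotz_term.
replace (RtoC (s / 2) * Cconj w * (x - y))%C
  with ((RtoC s * Cconj w / (Ci * RtoC k)) * (Ci * RtoC k * (x - y) / 2))%C.
2:{ unfold Rdiv. rewrite RtoC_mult, RtoC_inv by lra. field; auto. }
rewrite Cpow_mult_l, Gamma_fact.
set (g := Gamma (INR m / INR n + 1)). unfold Rdiv at 1.
rewrite (RtoC_mult (INR (fact m))). as_C_eq. field.
split; [apply RtoC_INR_fact_neq_0|trivial].
Qed.

Lemma BesselJ_scaled_reduced (m : nat) (t : R) :
  BesselJ_scaled m t = bessel_reduced m (- (t / 2) ^ 2).
Proof.
unfold BesselJ_scaled. destruct (Req_dec_T t 0) as [->|Ht].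
- unfold bessel_reduced. symmetry.
  rewrite Series_incr_1 by apply ex_series_bessel.
  rewrite (Series_ext _ (fun _ => 0 * 0)).
  + rewrite Series_scal_l. unfold bessel_coef. rewrite Nat.add_0_r. simpl. field. apply INR_fact_neq_0.
  + intros j. simpl. field.
- unfold BesselJ, bessel_reduced. rewrite <- Series_scal_l. apply Series_ext. intros j.
  unfold bessel_coef. rewrite pow_add, pow_mult.
  replace (- (t / 2) ^ 2) with ((-1) * (t / 2) ^ 2) by ring. rewrite Rpow_mult_distr.
  replace ((2 / t) ^ m) with (/ (t / 2) ^ m).
  2:{ rewrite <- pow_inv. f_equal. field. trivial. }
  field. repeat split; try apply INR_fact_neq_0. apply pow_nonzero.
  unfold Rdiv. apply Rmult_integral_contrapositive; split; trivial. lra.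
Qed.

Lemma Edir_expand (k s : R) (n : nat) (w z : C) : Cmod w = 1 ->
  Edir n z s k w = CSeries (fun m => herglotz_term k s n w m z).
Proof.
intros Hw. unfold Edir, Efun.
assert (E : (dot z w, dot z (perp w)) = (Cconj w * z)%C).
{ unfold dot, perp. apply injective_projections; simpl; ring. }
rewrite E.
assert (Hext : forall a b : nat -> C, (forall m, a m = b m) -> CSeries a = CSeries b).
{ intros a b H. unfold CSeries. f_equal; apply Series_ext; intros m; now rewrite H. }
apply Hext. intros m. unfold herglotz_term.
rewrite BesselJ_scaled_reduced, Cmod_mult, Cmod_conj, Hw, Rmult_1_l.
replace (/ INR n * INR m + 1) with (INR m / INR n + 1) by (unfold Rdiv; ring).
assert (1 <= INR m / INR n + 1).
{ assert (0 <= INR m / INR n).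
  { unfold Rdiv. apply Rmult_le_pos; [apply pos_INR|].
    destruct n; [simpl; rewrite Rinv_0; lra|].
    left; apply Rinv_0_lt_compat, lt_0_INR; lia. }
  lra. }
rewrite RtoC_inv by (apply Rgt_not_eq, Gamma_pos; trivial).
rewrite Cmult_assoc. unfold Cdiv. ring.
Qed.

(** * Tails of Mittag-Leffler series *)

Lemma sum_n_Rsucc (a : nat -> R) (n : nat) : sum_n a (S n) = sum_n a n + a (S n).
Proof. exact (sum_Sn a n). Qed.

(** The block sums are dominated by a geometric series of ratio 1/2, so twice the
    first block bounds the total. *)
Lemma series_le_of_block_halving (a : nat -> R) (n : nat) :
  (forall m, 0 <= a m) -> (forall m, a (m + S n)%nat <= a m / 2) ->
  ex_series a /\ Series a <= 2 * sum_n a n.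
Proof.
intros Hpos Hhalf.
assert (Hincr : forall m p, sum_n a m <= sum_n a (m + p)).
{ intros m p. induction p as [|p IH]; [rewrite Nat.add_0_r; lra|].
  rewrite Nat.add_succ_r, sum_n_Rsucc. specialize (Hpos (S (m + p))). lra. }
assert (Hblock : forall m, sum_n a (m + S n) <= sum_n a n + sum_n a m / 2).
{ induction m as [|m IH].
  - rewrite Nat.add_0_l, sum_n_Rsucc, sum_O. specialize (Hhalf 0%nat). rewrite Nat.add_0_l in Hhalf. lra.
  - rewrite Nat.add_succ_l, !sum_n_Rsucc. specialize (Hhalf (S m)). rewrite Nat.add_succ_l in Hhalf. lra. }
assert (Hbd : forall m, sum_n a m <= 2 * sum_n a n).
{ intros m. specialize (Hincr m (S n)). specialize (Hblock m). lra. }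
destruct (ex_finite_lim_seq_incr (sum_n a) (2 * sum_n a n)) as [l Hl]; trivial.
{ intros m. specialize (Hincr m 1%nat). now rewrite Nat.add_1_r in Hincr. }
split; [now exists l|].
rewrite (is_series_unique a l Hl).
apply (is_lim_seq_le (sum_n a) (fun _ => 2 * sum_n a n) l (2 * sum_n a n)); trivial.
apply is_lim_seq_const.
Qed.

(** The general term of the Mittag-Leffler series of order [1/n] at [T]. *)
Definition mittag_leffler_term (n : nat) (T : R) (m : nat) : R := / Gamma (INR m / INR n + 1) * T ^ m.

Lemma div_INR_nonneg (m n : nat) : 0 <= INR m / INR n.
Proof.
unfold Rdiv. apply Rmult_le_pos; [apply pos_INR|].
destruct n; [simpl; rewrite Rinv_0; lra|].
left; apply Rinv_0_lt_compat, lt_0_INR; lia.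
Qed.

Lemma inv_Gamma_pos (m n : nat) : 0 < / Gamma (INR m / INR n + 1).
Proof. apply Rinv_0_lt_compat, Gamma_pos. pose proof (div_INR_nonneg m n). lra. Qed.

Lemma mittag_leffler_term_nonneg (n : nat) (T : R) (m : nat) : 0 <= T -> 0 <= mittag_leffler_term n T m.
Proof.
intros HT. apply Rmult_le_pos; [apply Rlt_le, inv_Gamma_pos|now apply pow_le].
Qed.

(** The functional equation of Gamma relates terms at distance [n] only, which
    is why the series is treated in blocks of [n] terms. *)
Lemma mittag_leffler_term_step (n : nat) (T : R) (m : nat) : (1 <= n)%nat ->
  mittag_leffler_term n T (m + n) = mittag_leffler_term n T m * (T ^ n / (INR m / INR n + 1)).
Proof.
intros Hn. unfold mittag_leffler_term.
assert (Hn' : INR n <> 0) by (apply not_0_INR; lia).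
pose proof (div_INR_nonneg m n) as Hm.
replace (INR (m + n) / INR n + 1) with (INR m / INR n + 1 + 1) by (rewrite plus_INR; now field).
rewrite Gamma_succ, pow_add by lra.
pose proof (Gamma_pos (INR m / INR n + 1) ltac:(lra)).
unfold Rdiv at 4. rewrite Rinv_mult. ring.
Qed.

Lemma mittag_leffler_term_block_le (n : nat) (T : R) (M m : nat) : (1 <= n)%nat -> 0 <= T ->
  (n * M <= m)%nat -> mittag_leffler_term n T (m + n) <= mittag_leffler_term n T m * (T ^ n / INR (S M)).
Proof.
intros Hn HT Hm. rewrite mittag_leffler_term_step by trivial.
apply Rmult_le_compat_l; [now apply mittag_leffler_term_nonneg|].
apply Rmult_le_compat_l; [now apply pow_le|].
apply Rinv_le_contravar; [apply lt_0_INR; lia|].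
rewrite S_INR. apply Rplus_le_compat_r.
assert (Hn' : 0 < INR n) by (apply lt_0_INR; lia).
apply (Rmult_le_reg_l (INR n)); trivial.
replace (INR n * (INR m / INR n)) with (INR m) by (field; lra).
rewrite <- mult_INR. now apply le_INR.
Qed.

Lemma mittag_leffler_tail_le (n : nat) (T : R) (M : nat) : (1 <= n)%nat -> 0 <= T -> T ^ n <= INR (S M) / 2 ->
  ex_series (mittag_leffler_term n T) /\
  Series (fun j => mittag_leffler_term n T (S (n * M) + j))
    <= 2 * sum_n (fun j => mittag_leffler_term n T (S (n * M) + j)) (pred n).
Proof.
intros Hn HT HM.
destruct (series_le_of_block_halving (fun j => mittag_leffler_term n T (S (n * M) + j)) (pred n)) as [H1 H2].
- intros m. now apply mittag_leffler_term_nonneg.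
- intros m. replace (S (n * M) + (m + S (pred n)))%nat with (S (n * M) + m + n)%nat by lia.
  eapply Rle_trans; [apply (mittag_leffler_term_block_le n T M); trivial; lia|].
  apply Rmult_le_compat_l; [now apply mittag_leffler_term_nonneg|].
  assert (0 < INR (S M)) by (apply lt_0_INR; lia).
  apply (Rmult_le_reg_r (INR (S M))); trivial. field_simplify; lra.
- split; trivial. apply (ex_series_incr_n _ (S (n * M))). exact H1.
Qed.

Lemma ex_series_mittag_leffler_term (n : nat) (T : R) : (1 <= n)%nat -> 0 <= T -> ex_series (mittag_leffler_term n T).
Proof.
intros Hn HT. destruct (INR_unbounded (2 * T ^ n)) as [M HM].
apply (mittag_leffler_tail_le n T M); trivial. rewrite S_INR. lra.
Qed.

Lemma mittag_leffler_term_le (n : nat) (T : R) (N i : nat) : (1 <= n)%nat -> 0 <= T ->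
  mittag_leffler_term n T (n * N + i) <= mittag_leffler_term n T i * ((T ^ n) ^ N / INR (fact N)).
Proof.
intros Hn HT. induction N as [|N IH].
- rewrite Nat.mul_0_r. simpl. lra.
- replace (n * S N + i)%nat with (n * N + i + n)%nat by lia.
  eapply Rle_trans; [apply (mittag_leffler_term_block_le n T N); trivial; lia|].
  eapply Rle_trans; [apply Rmult_le_compat_r; [|exact IH]|].
  + apply Rmult_le_pos; [now apply pow_le|].
    left; apply Rinv_0_lt_compat, lt_0_INR; lia.
  + right. rewrite fact_simpl, mult_INR. simpl pow at 4. field.
    split; [apply INR_fact_neq_0|apply not_0_INR; lia].
Qed.

Lemma pow_le_1_plus (T : R) (i n : nat) : 0 <= T -> (i <= n)%nat -> T ^ i <= 1 + T ^ n.
Proof.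
intros HT Hi. pose proof (pow_le T n HT). destruct (Rle_lt_dec T 1) as [H1|H1].
- pose proof (pow_incr T 1 i (conj HT H1)). rewrite pow1 in *. lra.
- pose proof (Rle_pow T i n ltac:(lra) Hi). lra.
Qed.

Lemma pow_mult_geom_bounded (q : R) (p : nat) : 0 < q < 1 ->
  exists M : R, forall N : nat, INR N ^ p * q ^ N <= M.
Proof.
intros Hq. set (c := - ln q).
assert (Hc : 0 < c).
{ pose proof (ln_increasing q 1 ltac:(lra) ltac:(lra)) as H. rewrite ln_1 in H. unfold c. lra. }
exists (INR (fact p) / c ^ p). intros N.
assert (Eq : q ^ N = / exp (c * INR N)).
{ rewrite <- exp_Ropp. unfold c. replace (- (- ln q * INR N)) with (INR N * ln q) by ring.
  rewrite <- (Rpower_pow N q) by lra. reflexivity. }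
rewrite Eq.
pose proof (pow_div_fact_le_exp (c * INR N) p ltac:(apply Rmult_le_pos; [lra|apply pos_INR])) as H.
pose proof (exp_pos (c * INR N)). pose proof (INR_fact_lt_0 p). pose proof (pow_lt c p Hc).
apply (Rmult_le_reg_r (exp (c * INR N))); trivial.
rewrite Rmult_assoc, Rinv_l, Rmult_1_r by lra.
apply (Rmult_le_compat_l (INR (fact p) / c ^ p)) in H.
2:{ left; now apply Rdiv_lt_0_compat. }
eapply Rle_trans; [|exact H]. right. rewrite Rpow_mult_distr. field. lra.
Qed.

Lemma exp_1_ge_2 : 2 <= exp 1.
Proof. pose proof (exp_ineq1_le 1). lra. Qed.

(** With [T^n <= q N / e] and [gamma < q < 1], the terms near index [n N] are at
    most [(q N / e)^N / N! <= q^N] up to a factor [O(N)], because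
    [N^N / N! <= e^N]; beyond that index the blocks halve since [q / e <= 1/2].
    So the tail is exponentially small in [N]. *)
Lemma mittag_leffler_tail_rapidly_decreasing (n : nat) (T : nat -> R) (gamma : R) (p : nat) :
  (1 <= n)%nat -> 0 < gamma < 1 -> (forall N, (1 <= N)%nat -> 0 <= T N) ->
  bounded_eventually (fun N => T N ^ n - gamma / exp 1 * INR N) ->
  exists M : R, 0 <= M /\
    eventually (fun N => Series (fun j => mittag_leffler_term n (T N) (S (n * N) + j)) <= M / INR N ^ p).
Proof.
intros Hn Hg HT [C [N1 HC]].
pose proof exp_1_ge_2 as He.
set (q := (1 + gamma) / 2). assert (Hq : gamma < q < 1) by (unfold q; lra).
set (G := sum_n (fun j => / Gamma (INR (S j) / INR n + 1)) (pred n)).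
assert (HG : 0 <= G).
{ unfold G. generalize (pred n). induction n0 as [|j IH].
  - rewrite sum_O. left; apply inv_Gamma_pos.
  - rewrite sum_n_Rsucc. pose proof (inv_Gamma_pos (S (S j)) n). lra. }
destruct (pow_mult_geom_bounded q (S p)) as [M HM]; [lra|].
assert (HM0 : 0 <= M).
{ eapply Rle_trans; [|apply (HM 0%nat)]. simpl. rewrite Rmult_0_l, Rmult_0_l. lra. }
exists (4 * G * M). split.
{ apply Rmult_le_pos; trivial. apply Rmult_le_pos; lra. }
(* Beyond [N2] the bounded error [C] is absorbed by raising [gamma] to [q]. *)
destruct (INR_unbounded (C * exp 1 / (q - gamma))) as [N2 HN2].
exists (S (N1 + N2)). intros N HN.
assert (HN1 : 1 <= INR N) by (apply (le_INR 1); lia).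
specialize (HC N ltac:(lia)). specialize (HT N ltac:(lia)).
set (t := T N) in *.
assert (Ht : t ^ n <= q / exp 1 * INR N).
{ apply Rabs_le_between in HC.
  assert (C * exp 1 < (q - gamma) * INR N).
  { assert (INR N2 < INR N) by (apply lt_INR; lia).
    apply (Rmult_lt_reg_r (/ (q - gamma))); [apply Rinv_0_lt_compat; lra|].
    replace ((q - gamma) * INR N * / (q - gamma)) with (INR N) by (field; lra).
    unfold Rdiv in HN2. lra. }
  assert (C <= (q - gamma) / exp 1 * INR N).
  { apply (Rmult_le_reg_r (exp 1)); [lra|].
    replace ((q - gamma) / exp 1 * INR N * exp 1) with ((q - gamma) * INR N) by (field; lra). lra. }
  replace (q / exp 1 * INR N)
    with ((q - gamma) / exp 1 * INR N + gamma / exp 1 * INR N) by (field; lra).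
  lra. }
assert (Hqe : 0 < q / exp 1 <= 1 / 2).
{ split; [apply Rdiv_lt_0_compat; lra|].
  apply (Rmult_le_reg_r (exp 1)); [lra|]. unfold Rdiv at 1. rewrite Rmult_assoc, Rinv_l by lra. lra. }
assert (Htn : 0 <= t ^ n) by now apply pow_le.
assert (HtN : t ^ n <= INR N / 2).
{ eapply Rle_trans; [exact Ht|]. replace (INR N / 2) with (1 / 2 * INR N) by field.
  apply Rmult_le_compat_r; lra. }
destruct (mittag_leffler_tail_le n t N) as [_ Htail]; trivial.
{ rewrite S_INR. lra. }
eapply Rle_trans; [exact Htail|].
assert (Hpow : (t ^ n) ^ N / INR (fact N) <= q ^ N).
{ pose proof (pow_div_fact_le_exp (INR N) N (pos_INR N)) as HNN.
  assert (EN : exp (INR N) = exp 1 ^ N).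
  { rewrite <- Rpower_pow by apply exp_pos. unfold Rpower. now rewrite ln_exp, Rmult_1_r. }
  rewrite EN in HNN.
  apply Rle_trans with ((q / exp 1 * INR N) ^ N / INR (fact N)).
  - apply Rmult_le_compat_r; [left; apply Rinv_0_lt_compat, INR_fact_lt_0|].
    apply pow_incr; lra.
  - assert (H0 : 0 <= (q / exp 1) ^ N) by (apply pow_le; lra).
    apply (Rmult_le_compat_l _ _ _ H0) in HNN.
    replace (q ^ N) with ((q / exp 1) ^ N * exp 1 ^ N).
    + eapply Rle_trans; [|exact HNN]. right. rewrite Rpow_mult_distr. unfold Rdiv; ring.
    + rewrite <- Rpow_mult_distr. f_equal. field. lra. }
assert (Hterm : forall j, (j <= pred n)%nat ->
   mittag_leffler_term n t (S (n * N) + j) <= / Gamma (INR (S j) / INR n + 1) * (2 * INR N * q ^ N)).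
{ intros j Hj. replace (S (n * N) + j)%nat with (n * N + S j)%nat by lia.
  eapply Rle_trans; [apply mittag_leffler_term_le; trivial|]. unfold mittag_leffler_term. rewrite Rmult_assoc.
  apply Rmult_le_compat_l; [apply Rlt_le, inv_Gamma_pos|].
  apply Rmult_le_compat; trivial.
  - now apply pow_le.
  - apply Rmult_le_pos; [now apply pow_le|left; apply Rinv_0_lt_compat, INR_fact_lt_0].
  - pose proof (pow_le_1_plus t (S j) n HT ltac:(lia)). lra. }
assert (Hsum : sum_n (fun j => mittag_leffler_term n t (S (n * N) + j)) (pred n) <= G * (2 * INR N * q ^ N)).
{ unfold G. revert Hterm. generalize (pred n) as l. induction l as [|l IH]; intros Hterm.
  - rewrite !sum_O. auto.
  - rewrite !sum_n_Rsucc, Rmult_plus_distr_r. apply Rplus_le_compat; auto. }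
specialize (HM N). simpl in HM.
assert (HNp : 0 < INR N ^ p) by (apply pow_lt; lra).
apply (Rmult_le_reg_r (INR N ^ p)); trivial.
replace (4 * G * M / INR N ^ p * INR N ^ p) with (4 * G * M) by (field; lra).
apply Rle_trans with (4 * G * (INR N * INR N ^ p * q ^ N)).
- replace (4 * G * (INR N * INR N ^ p * q ^ N)) with (2 * (G * (2 * INR N * q ^ N)) * INR N ^ p) by ring.
  apply Rmult_le_compat_r; lra.
- apply Rmult_le_compat_l; [|exact HM]. lra.
Qed.

(** * The error term *)

Lemma jet_bound_RtoC_series (a : nat -> R) (v : C -> R) (z : C) (d A : R) :
  jet_bound (fun x => CSeries (fun j => RtoC (a j) * RtoC (v x) ^ j)%C) z d A ->
  (forall x, ex_series (fun j => a j * v x ^ j)) ->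
  jet_bound (fun x => RtoC (Series (fun j => a j * v x ^ j))) z d A.
Proof.
intros H Hex. eapply jet_bound_ext; [|exact H]. intros x. simpl.
apply CSeries_unique. eapply is_series_ext; [|apply is_series_RtoC, Series_correct, Hex].
intros j. simpl. now rewrite RtoC_mult, RtoC_pow.
Qed.

(** The reduced Bessel function is a power series in [x conj(x)] whose
    coefficients are dominated by those of the exponential; its majorant is
    evaluated at [|z| + d <= 2 rho]. *)
Lemma jet_bound_bessel (k rho d : R) (m : nat) (z : C) :
  0 < d -> Cmod z + d <= 2 * rho ->
  jet_bound (fun x => RtoC (bessel_reduced m (- (k * Cmod x / 2) ^ 2))) z d
    (exp ((k * rho) ^ 2)).
Proof.
intros Hd Hz. unfold bessel_reduced.
apply (jet_bound_RtoC_series (bessel_coef m) (fun x => - (k * Cmod x / 2) ^ 2));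
  [|intros x; apply ex_series_bessel].
apply (jet_bound_series _ _ _ (fun j => ((k * rho) ^ 2) ^ j / INR (fact j))); trivial;
  [|apply is_series_exp].
intros j. destruct (bessel_coef_bound m j) as [Hb1 Hb2].
apply (jet_bound_ext (fun x => RtoC (bessel_coef m j * (- (k / 2) ^ 2) ^ j) * (x * Cconj x) ^ j)%C).
{ intros x. rewrite <- Cmod2_conj, <- RtoC_pow, <- RtoC_mult, <- RtoC_pow, <- RtoC_mult.
  f_equal. rewrite Rmult_assoc, <- Rpow_mult_distr. f_equal. f_equal. field. }
assert (Hrho : 0 <= (Cmod z + d) * (Cmod z + d) <= (2 * rho) * (2 * rho)).
{ pose proof (Cmod_ge_0 z). split; [apply Rmult_le_pos; lra|apply Rmult_le_compat; lra]. }
eapply jet_bound_weaken; [|apply jet_bound_mult; [lra|apply jet_bound_const|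
  apply jet_bound_pow; [lra|apply jet_bound_mult; [lra|apply jet_bound_id|
    apply jet_bound_conj, jet_bound_id]]]].
rewrite Cmod_R, Rabs_mult, (Rabs_pos_eq (bessel_coef m j)) by trivial.
rewrite <- RPow_abs, Rabs_Ropp, (Rabs_pos_eq ((k / 2) ^ 2)) by apply pow2_ge_0.
rewrite Rmult_assoc, <- Rpow_mult_distr.
unfold Rdiv at 2. rewrite (Rmult_comm (_ ^ j)).
apply Rmult_le_compat; trivial.
- apply pow_le, Rmult_le_pos; [apply pow2_ge_0|apply Hrho].
- apply pow_incr. split; [apply Rmult_le_pos; [apply pow2_ge_0|apply Hrho]|].
  replace ((k * rho) ^ 2) with ((k / 2) ^ 2 * (2 * rho * (2 * rho))) by field.
  apply Rmult_le_compat_l; [apply pow2_ge_0|apply Hrho].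
Qed.

Lemma jet_bound_herglotz_term (k s rho d : R) (n m : nat) (w z : C) :
  0 <= s -> Cmod w = 1 -> 0 < d -> Cmod z + d <= 2 * rho ->
  jet_bound (herglotz_term k s n w m) z d (mittag_leffler_term n (rho * s) m * exp ((k * rho) ^ 2)).
Proof.
intros Hs Hw Hd Hz. unfold herglotz_term.
apply jet_bound_mult; [lra| |now apply jet_bound_bessel].
eapply jet_bound_weaken; [|apply jet_bound_mult; [lra|apply jet_bound_const|
  apply jet_bound_pow; [lra|apply jet_bound_mult; [lra|apply jet_bound_const|apply jet_bound_id]]]].
unfold mittag_leffler_term. pose proof (inv_Gamma_pos m n).
rewrite Cmod_R, Rabs_pos_eq by lra. apply Rmult_le_compat_l; [lra|].
rewrite Cmod_mult, Cmod_conj, Hw, Cmod_R, Rabs_pos_eq by lra.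
pose proof (Cmod_ge_0 z).
apply pow_incr. split; [apply Rmult_le_pos; lra|].
replace (rho * s) with (s / 2 * 1 * (2 * rho)) by field.
apply Rmult_le_compat_l; lra.
Qed.

Lemma ex_series_herglotz_term (k s : R) (n : nat) (w z : C) :
  (1 <= n)%nat -> 0 <= s -> Cmod w = 1 ->
  ex_series (fun m => Cmod (herglotz_term k s n w m z)).
Proof.
intros Hn Hs Hw. set (rho := (Cmod z + 1) / 2).
pose proof (Cmod_ge_0 z).
apply (ex_series_Cmod_le _ (fun m => mittag_leffler_term n (rho * s) m * exp ((k * rho) ^ 2))).
- intros m. replace z with (z + 0)%C by ring.
  apply (jet_bound_value _ z 0 1); [|rewrite Cmod_0; lra].
  apply jet_bound_herglotz_term; trivial; unfold rho; lra.
- apply ex_series_scal_r, ex_series_mittag_leffler_term; trivial.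
  apply Rmult_le_pos; trivial. unfold rho; lra.
Qed.

Lemma herglotz_error_tail (k s : R) (n N : nat) (w y x : C) :
  k <> 0 -> (1 <= n)%nat -> 0 <= s -> Cmod w = 1 ->
  (- CSeries (fun j => herglotz_term k s n w (S (n * N) + j) (x - y)))%C =
  (Herglotz k (herglotz_density n y w s k N) x - Edir n (x - y) s k w)%C.
Proof.
intros Hk Hn Hs Hw.
rewrite Herglotz_density_expand, Edir_expand by trivial.
set (a := fun m => herglotz_term k s n w m (x - y)%C).
assert (Ha : C_is_series a (CSeries a)).
{ apply CSeries_correct. exact (ex_series_herglotz_term k s n w (x - y)%C Hn Hs Hw). }
rewrite (CSeries_unique _ (CSeries a - sum_n (G := C_AbelianGroup) a (n * N))%C).
- ring.
- apply (is_series_incr_n (V := C_NormedModule) a (S (n * N))); [lia|].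
  simpl pred.
  match goal with |- C_is_series _ ?v => replace v with (CSeries a); [exact Ha|] end.
  change (CSeries a = CSeries a - sum_n (G := C_AbelianGroup) a (n * N)
    + sum_n (G := C_AbelianGroup) a (n * N))%C.
  ring.
Qed.

Lemma jet_bound_herglotz_error (k s rho d : R) (n N : nat) (w y x : C) :
  k <> 0 -> (1 <= n)%nat -> 0 <= s -> Cmod w = 1 -> 0 < d -> Cmod (x - y) + d <= 2 * rho ->
  jet_bound
    (fun x => Herglotz k (herglotz_density n y w s k N) x - Edir n (x - y) s k w)%C x d
    (Series (fun j => mittag_leffler_term n (rho * s) (S (n * N) + j)) * exp ((k * rho) ^ 2)).
Proof.
intros Hk Hn Hs Hw Hd Hx.
apply (jet_bound_ext _ _ _ _ _ (fun x => herglotz_error_tail k s n N w y x Hk Hn Hs Hw)).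
apply jet_bound_opp.
apply (jet_bound_shift (fun z => CSeries (fun j => herglotz_term k s n w (S (n * N) + j) z))).
apply (jet_bound_series _ _ _ (fun j => mittag_leffler_term n (rho * s) (S (n * N) + j) * exp ((k * rho) ^ 2)));
  trivial.
- intros j. now apply jet_bound_herglotz_term.
- apply is_series_scal_r, Series_correct.
  apply (ex_series_incr_n (mittag_leffler_term n (rho * s)) (S (n * N))).
  apply ex_series_mittag_leffler_term; trivial. apply Rmult_le_pos; trivial.
  pose proof (Cmod_ge_0 (x - y)). lra.
Qed.

Lemma sup_disc_bounds (r B : R) (h : C -> R) : 0 <= r ->
  (forall x, Cmod x <= r -> 0 <= h x <= B) ->
  exists u : R, sup_disc r h = Finite u /\ 0 <= u <= B.
Proof.
intros Hr Hh. unfold sup_disc.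
destruct (Lub_Rbar_correct (fun v => exists x : C, Cmod x <= r /\ v = h x)) as [Hub Hlub].
set (E := fun v => exists x : C, Cmod x <= r /\ v = h x) in *.
assert (H1 : Rbar_le (Lub_Rbar E) B).
{ apply Hlub. intros v (x & Hx & ->). apply (Hh x Hx). }
assert (H2 : Rbar_le 0 (Lub_Rbar E)).
{ assert (H0 : Cmod 0 <= r) by now rewrite Cmod_0.
  apply (Rbar_le_trans 0 (h 0)); [apply (Hh 0 H0)|]. apply Hub. now exists 0%C. }
destruct (Lub_Rbar E) as [u| |]; simpl in H1, H2; try contradiction.
now exists u.
Qed.

(** This places [gamma] below 1, so that [gamma^N] decays. *)
Lemma gamma0_lt_1 (gamma0 : R) :
  0 < gamma0 -> ln gamma0 + gamma0 / exp 1 = 0 -> gamma0 < 1.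
Proof.
intros H0 H. apply ln_lt_inv; [trivial|lra|]. rewrite ln_1.
pose proof (Rdiv_lt_0_compat _ _ H0 (exp_pos 1)). lra.
Qed.

Theorem corollary3p1 (k r : R) (n : nat) (gamma0 gamma : R) (s : nat -> R)
    (hk : 0 < k) (hr : 0 < r) (hn : (1 <= n)%nat)
    (hgamma0_pos : 0 < gamma0)
    (hgamma0_eq : ln gamma0 + gamma0 / exp 1 = 0)
    (hgamma_pos : 0 < gamma) (hgamma_lt : gamma < gamma0)
    (hs_pos : forall N : nat, (1 <= N)%nat -> 0 < s N)
    (hs : bounded_eventually
            (fun N => (r * s N) ^ n - gamma / exp 1 * INR N))
    (y w : C) (hy : Cmod y < r) (hw : Cmod w = 1) :
  let D (N : nat) (x : C) : C :=
    (Herglotz k (herglotz_density n y w (s N) k N) x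
     - Edir n (x - y) (s N) k w)%C in
  (forall (N : nat) (x : C), (1 <= N)%nat -> Cmod x <= r ->
     differentiable_at (D N) x) /\
  rapidly_decreasing (fun N =>
    Rbar_plus (sup_disc r (fun x => Cmod (D N x)))
              (sup_disc r (fun x => grad_norm (D N) x))).
Proof.
intros D.
(* With this radius [|x - y| + d <= 2 r] for every [x] in the closed disc. *)
set (d := r - Cmod y). assert (Hd : 0 < d) by (unfold d; lra).
set (A := fun N => Series (fun j => mittag_leffler_term n (r * s N) (S (n * N) + j)) * exp ((k * r) ^ 2)).
assert (Hjet : forall N x, (1 <= N)%nat -> Cmod x <= r -> jet_bound (D N) x d (A N)).
{ intros N x HN Hx.
  assert (Hk0 : k <> 0) by lra.
  pose proof (Rlt_le _ _ (hs_pos N HN)) as Hs0.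
  assert (Hxd : Cmod (x - y) + d <= 2 * r).
  { pose proof (Cmod_triangle x (- y)). rewrite Cmod_opp in *. unfold d, Cminus. lra. }
  exact (jet_bound_herglotz_error k (s N) r d n N w y x Hk0 hn Hs0 hw Hd Hxd). }
split.
{ intros N x HN Hx. now apply (jet_bound_differentiable _ _ d (A N)), Hjet. }
intros p _.
pose proof (gamma0_lt_1 gamma0 hgamma0_pos hgamma0_eq).
destruct (mittag_leffler_tail_rapidly_decreasing n (fun N => r * s N) gamma p) as (M & HM & N0 & HN0); trivial.
{ lra. }
{ intros N HN. apply Rmult_le_pos; [lra|apply Rlt_le; auto]. }
exists ((1 + 2 / d) * (M * exp ((k * r) ^ 2))). exists (S N0). intros N HN.
assert (HN1 : (1 <= N)%nat) by lia.
destruct (sup_disc_bounds r (A N) (fun x => Cmod (D N x))) as (u1 & E1 & Hu1); [lra| |].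
{ intros x Hx. split; [apply Cmod_ge_0|].
  replace x with (x + 0)%C by ring. apply (jet_bound_value _ _ _ d); [auto|rewrite Cmod_0; lra]. }
destruct (sup_disc_bounds r (2 * A N / d) (fun x => grad_norm (D N) x)) as (u2 & E2 & Hu2); [lra| |].
{ intros x Hx. split; [apply sqrt_pos|apply jet_bound_grad; auto]. }
rewrite E1, E2.
change (Rabs (u1 + u2) <= (1 + 2 / d) * (M * exp ((k * r) ^ 2)) / INR N ^ p).
rewrite Rabs_pos_eq by lra.
assert (HA : A N <= M * exp ((k * r) ^ 2) / INR N ^ p).
{ unfold A. replace (M * exp ((k * r) ^ 2) / INR N ^ p) with (M / INR N ^ p * exp ((k * r) ^ 2)).
  - apply Rmult_le_compat_r; [left; apply exp_pos|]. apply HN0. lia.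
  - unfold Rdiv; ring. }
apply Rle_trans with ((1 + 2 / d) * A N).
- replace ((1 + 2 / d) * A N) with (A N + 2 * A N / d) by (field; lra). lra.
- replace ((1 + 2 / d) * (M * exp ((k * r) ^ 2)) / INR N ^ p)
    with ((1 + 2 / d) * (M * exp ((k * r) ^ 2) / INR N ^ p)) by (unfold Rdiv; ring).
  apply Rmult_le_compat_l; trivial.
  assert (0 < 2 / d) by (apply Rdiv_lt_0_compat; lra). lra.
Qed.
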